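(* Let $k\ge1$ be an integer, $0<b<1$, $0<p<1$, and let $\mu$ be a probability distribution on $\mathbb{R}$. Then there exists a marginally stationary randomized additive AR(1) scheme with parameters $(k,b,p)$ in which $Y_{i,0}\overset{d}{=}\varepsilon_{i,1}$ and every $Y_{i,n}$ has law $\mu$ if and only if $\mu$ is generalized semi-$\alpha$-Laplace($\frac1p,b,k$).
   Context: A randomized additive AR(1) scheme with parameters $(k,b,p)$ consists of real random variables, on some probability space, $Y_{i,n}$ ($1\le i\le k$, $n\ge0$), $\varepsilon_{i,n}$ ($1\le i\le k$, $n\ge1$) and $I_n\in\{0,1\}$ ($n\ge1$) with $P(I_n=0)=p$, $P(I_n=1)=1-p$, such that: for each $n$, $Y_{1,n},\dots,Y_{k,n}$ are i.i.d.; all $\varepsilon_{i,n}$ are i.i.d.; for each $n\ge1$, $I_n$, $(\varepsilon_{i,n})_{i\le k}$ and $(Y_{i,m})_{i\le k,\,m<n}$ are independent; and almost surely for all $n\ge1$ $$\sum_{i=1}^kY_{i,n}=b\sum_{i=1}^kY_{i,n-1}+I_n\sum_{i=1}^k\varepsilon_{i,n}.$$ (That is, with probability $p$ the innovation term is absent, and with probability $1-p$ it is added.) The scheme is marginally stationary if $Y_{i,n}\overset d=Y_{i,n-1}$ for all $i$ and all $n\ge1$. For $0<b<1<a$ and an integer $k\ge1$, a distribution is generalized semi-$\alpha$-Laplace($a,b,k$) if its characteristic function has the form $\{1+\psi(t)\}^{-1/k}$, $t\in\mathbb{R}$, where $\psi:\mathbb{R}\to\mathbb{C}$ satisfies $\psi(t)=a\psi(bt)$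 for all $t$, and $ab^\alpha=1$ for some $\alpha\in(0,2]$ (the power is the continuous branch equal to $1$ at $t=0$).
   Formalization: The case where μ is the point mass at 0 and p < b² is excluded: there the zero scheme exists, but (1/p)b^α = 1 forces α > 2, so μ is not generalized semi-α-Laplace(1/p,b,k) and the claim fails. *)

(* Defs.v *)
From HB Require Import structures.
From mathcomp Require Import all_boot all_order all_algebra finmap.
From mathcomp Require Import all_classical all_reals all_analysis.
From mathcomp Require Export complex.

Set Implicit Arguments.
Unset Strict Implicit.
Unset Printing Implicit Defensive.

Import Order.TTheory GRing.Theory Num.Theory.
Import numFieldNormedType.Exports.

Local Open Scope classical_set_scope.
Local Open Scope ring_scope.
Local Open Scope complex_scope.

Definition has_law d (T : measurableType d) (R : realType)
    (P : probability T R) (X : {RV P >-> R}) (mu : probability R R) : Prop :=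
  forall A : set R, measurable A -> distribution P X A = mu A.

Definition same_law d (T : measurableType d) (R : realType)
    (P : probability T R) (X Y : {RV P >-> R}) : Prop :=
  forall A : set R, measurable A -> distribution P X A = distribution P Y A.

Definition sigma_gen d (T : measurableType d) (R : realType)
    (P : probability T R) (J : Type) (D : set J) (X : J -> {RV P >-> R}) :
    set (set T) :=
  <<s \bigcup_(j in D) preimage_set_system setT (X j) measurable >>.

Definition mutually_independent d (T : measurableType d) (R : realType)
    (P : probability T R) (J : choiceType) (D : set J)
    (X : J -> {RV P >-> R}) : Prop :=
  forall (B : {fset J}) (A : J -> set R),
    [set` B] `<=` D -> (forall j, measurable (A j)) ->
    P (\bigcap_(j in [set` B]) X j @^-1` A j) =
      (\prod_(j <- B) P (X j @^-1` A j))%E.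

Definition iid d (T : measurableType d) (R : realType) (P : probability T R)
    (J : choiceType) (D : set J) (X : J -> {RV P >-> R}) : Prop :=
  mutually_independent D X /\
  (forall i j, D i -> D j -> same_law (X i) (X j)).

(* Meant for sigma-algebras: these contain the whole space, so the product
   rule for two of the three events is a special case. *)
Definition independent3 d (T : measurableType d) (R : realType)
    (P : probability T R) (F G H : set (set T)) : Prop :=
  forall A B C, F A -> G B -> H C ->
    P (A `&` B `&` C) = (P A * P B * P C)%E.

(* The values eps i 0 and I 0 are not part of the scheme and are left
   unconstrained. *)
Record randomized_additive_AR1 d (T : measurableType d) (R : realType)
    (P : probability T R) (k : nat) (b p : R)
    (Y eps : 'I_k -> nat -> {RV P >-> R}) (I : nat -> {RV P >-> R}) : Prop := {
  I_range : forall n w, (0 < n)%N -> I n w = 0 \/ I n w = 1 ;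
  I_eq0 : forall n, (0 < n)%N -> P [set w | I n w = 0] = p%:E ;
  I_eq1 : forall n, (0 < n)%N -> P [set w | I n w = 1] = (1 - p)%:E ;
  Y_iid : forall n, iid setT (fun i => Y i n) ;
  eps_iid : iid [set q : 'I_k * nat | (0 < q.2)%N] (fun q => eps q.1 q.2) ;
  innovation_indep : forall n, (0 < n)%N ->
    independent3 P
      (sigma_gen [set n] I)
      (sigma_gen setT (fun i => eps i n))
      (sigma_gen [set q : 'I_k * nat | (q.2 < n)%N] (fun q => Y q.1 q.2)) ;
  AR1_eq : {ae P, forall w, forall n, (0 < n)%N ->
    \sum_(i < k) Y i n w =
      b * \sum_(i < k) Y i n.-1 w + I n w * \sum_(i < k) eps i n w } }.

Definition marginally_stationary d (T : measurableType d) (R : realType)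
    (P : probability T R) (k : nat) (Y : 'I_k -> nat -> {RV P >-> R}) : Prop :=
  forall i n, (0 < n)%N -> same_law (Y i n) (Y i n.-1).

Definition char_fun (R : realType) (mu : probability R R) (t : R) : R[i] :=
  (\int[mu]_x cos (t * x)) +i* (\int[mu]_x sin (t * x)).

(* g is the continuous branch, equal to 1 at 0, of z ^ (-1/k): each g t is one
   of the k-th roots of (z t)^-1. Since 0^-1 = 0 in R[i], the power makes sense
   only if z t != 0 is required separately. *)
Definition is_inv_root_branch (R : realType) (k : nat) (z g : R -> R[i]) :
    Prop :=
  [/\ continuous (g : R -> (R[i])^o), g 0 = 1 &
      forall t, z t != 0 /\ g t ^+ k = (z t)^-1].

Definition gen_semi_alpha_Laplace (R : realType) (a b : R) (k : nat)
    (mu : probability R R) : Prop :=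
  exists psi : R -> R[i],
    [/\ is_inv_root_branch k (fun t => 1 + psi t) (char_fun mu),
        forall t, psi t = a%:C * psi (b * t) &
        exists alpha : R, 0 < alpha <= 2 /\ a * b `^ alpha = 1].

(* Main.v *)
(* Let f be the k-th power of the characteristic function of mu. Taking
   characteristic functions in the AR(1) equation gives
     f t = f (b t) (p + (1 - p) f t),
   that is, psi (b t) = p psi t for psi = 1 / f - 1. Here f has no zero, since a
   zero at t would propagate along b^n t to 0, and alpha = ln p / ln b is at most
   2: if p < b^2, then 1 - f (b^n) = O(p^n) while 1 - cos y is of order y^2, so
   mu would be the Dirac mass at 0, which is excluded when p < b^2.

   Conversely, the functional equation says that S = X_1 + ... + X_k, with X_i
   i.i.d. of law mu, has the law of b S + I S'. So a vector (X_i) whose sum is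
   exactly b S + I S' can be drawn from the conditional law of (X_i) given its
   sum, and iterating this yields the scheme. On the unit interval, where
   interleaving binary digits provides infinitely many independent uniform
   variables, a vector is encoded by one uniform seed, and the conditional law
   of the seed given the sum is sampled by a conditional quantile function. *)
From HB Require Import structures.
Require Import Defs.
From mathcomp Require Import all_boot all_order all_algebra finmap.
From mathcomp Require Import all_classical all_reals all_analysis.
From mathcomp Require Import measurable_realfun.
From mathcomp Require Import zify ring lra.

Set Implicit Arguments.
Unset Strict Implicit.
Unset Printing Implicit Defensive.
Import Order.TTheory GRing.Theory Num.Theory.
Import numFieldNormedType.Exports.
Local Open Scope classical_set_scope.
Local Open Scope ring_scope.

(** The obstacle in the converse is that the functional equation only equates laws, whereas the
    recursion must hold almost surely. The drawn seed has to satisfy two conditions at once: its sum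
    must reproduce the given value, and it must be uniform again so that the next step can start.
    Both are contained in one statement, that the pair (target, new seed) has the law of (S,
    identity). One conditional quantile function serves at every time, because the law of the target
    never changes. Injectivity of the characteristic function is obtained without inversion:
    trigonometric polynomials form an algebra, so polynomials in sin (t (x - c)) that approach a
    step function give equal masses to {sin (t (x - c)) < 0}, and small t turns this set into a ray.
    The condition on the Dirac mass is genuine: there f = 1 solves the functional equation for every
    p, while (1/p) b^alpha = 1 with alpha <= 2 means b^2 <= p. *)

Section bounded_integral.
Context d (T : measurableType d) (R : realType) (P : probability T R).

Lemma bounded_integrable (f : T -> R) (M : R) : measurable_fun setT f ->
  (forall x, `|f x| <= M) -> P.-integrable setT (EFin \o f).
Proof.
move=> mf fM; apply: measurable_bounded_integrable => //=.
  by rewrite fin_num_fun_lty //; exact: fin_num_measure.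
exists M; split; first exact: num_real.
by move=> x Mx y _; apply: le_trans (fM y) _; exact: ltW.
Qed.

Lemma cvg_Rintegral_bounded (f_ : nat -> T -> R) (f : T -> R) (M : R) :
  (forall n, measurable_fun setT (f_ n)) -> measurable_fun setT f ->
  (forall n x, `|f_ n x| <= M) -> (forall x, f_ n x @[n --> \oo] --> f x) ->
  (\int[P]_x f_ n x) @[n --> \oo] --> \int[P]_x f x.
Proof.
move=> mf_ mf fM f_f.
have [|||||iF _ cF] := @dominated_convergence _ _ _ P setT measurableT
  (fun n => EFin \o f_ n) (EFin \o f) (EFin \o cst M).
- by move=> n; exact/measurable_EFinP.
- exact/measurable_EFinP.
- apply: aeW => x _; apply: cvg_EFin; last exact: f_f.
  exact: nearW.
- apply: (@bounded_integrable (cst M) `|M|) => // x; exact: measurable_cst.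
- by apply: aeW => x n _ /=; rewrite lee_fin.
- rewrite -(fineK (integrable_fin_num measurableT iF)) in cF.
  by have /fine_cvgP[] := cF.
Qed.
End bounded_integral.

(** * Characteristic functions determine the law *)

Section trigonometric_polynomials.
Context (R : realType).
Implicit Types (f g : R -> R) (mu : probability R R).

(** Products are left out of the constructors, so that equality of integrals passes through each of
    them by linearity; closure under products is [trig_poly_mul]. *)
Inductive trig_poly : (R -> R) -> Prop :=
| trig_cos t : trig_poly (fun x => cos (t * x))
| trig_sin t : trig_poly (fun x => sin (t * x))
| trig_add f g : trig_poly f -> trig_poly g -> trig_poly (fun x => f x + g x)
| trig_scale c f : trig_poly f -> trig_poly (fun x => c * f x).

Lemma measurable_cos_lin t : measurable_fun setT (fun x : R => cos (t * x)).
Proof.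
apply: continuous_measurable_fun => x.
apply: continuous_comp; last exact: continuous_cos.
exact: mulrl_continuous.
Qed.

Lemma measurable_sin_lin t : measurable_fun setT (fun x : R => sin (t * x)).
Proof.
apply: continuous_measurable_fun => x.
apply: continuous_comp; last exact: continuous_sin.
exact: mulrl_continuous.
Qed.

Lemma trig_poly_measurable f : trig_poly f -> measurable_fun setT f.
Proof.
elim=> {f} [t|t|f g _ mf _ mg|c f _ mf].
- exact: measurable_cos_lin.
- exact: measurable_sin_lin.
- exact: measurable_funD.
- by apply: measurable_funM => //; exact: measurable_cst.
Qed.

Lemma trig_poly_bounded f : trig_poly f -> exists M, forall x, `|f x| <= M.
Proof.
elim=> {f} [t|t|f g _ [M fM] _ [N gN]|c f _ [M fM]].
- by exists 1 => x; rewrite ler_norml cos_geN1 cos_le1.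
- by exists 1 => x; rewrite ler_norml sin_geN1 sin_le1.
- by exists (M + N) => x; rewrite (le_trans (ler_normD _ _))// lerD.
- by exists (`|c| * M) => x; rewrite normrM ler_wpM2l.
Qed.

Lemma trig_poly_integrable mu f : trig_poly f -> mu.-integrable setT (EFin \o f).
Proof.
move=> tf; have [M fM] := trig_poly_bounded tf.
exact: bounded_integrable (trig_poly_measurable tf) fM.
Qed.

(** The product-to-sum formulas settle the four products of a sine or cosine with another;
    bilinearity does the rest. *)
Lemma trig_poly_mul f g : trig_poly f -> trig_poly g ->
  trig_poly (fun x => f x * g x).
Proof.
have sc (c : R) h h' : trig_poly h -> h' = (fun x => c * h x) -> trig_poly h'.
  by move=> th ->; exact: trig_scale.
have ad h1 h2 h : trig_poly h1 -> trig_poly h2 ->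
    h = (fun x => h1 x + h2 x) -> trig_poly h.
  by move=> ? ? ->; exact: trig_add.
move=> tf tg; elim: tf => {f} [t|t|f f' _ hf _ hf'|c f _ hf]; last 2 first.
- by apply: ad hf hf' _; apply/funext => x; rewrite mulrDl.
- by apply: sc hf _; apply/funext => x; rewrite mulrA.
- elim: tg => {g} [s|s|g g' _ hg _ hg'|c g _ hg]; last 2 first.
  + by apply: ad hg hg' _; apply/funext => x; rewrite mulrDr.
  + by apply: sc hg _; apply/funext => x; rewrite mulrCA.
  + apply: (ad _ _ _ (trig_scale (2^-1) (trig_cos (t - s)))
      (trig_scale (2^-1) (trig_cos (t + s)))); apply/funext => x.
    by rewrite mulrBl mulrDl cosB cosD; field.
  + apply: (ad _ _ _ (trig_scale (2^-1) (trig_sin (t + s)))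
      (trig_scale (- 2^-1) (trig_sin (t - s)))); apply/funext => x.
    by rewrite mulrBl mulrDl sinB sinD; field.
- elim: tg => {g} [s|s|g g' _ hg _ hg'|c g _ hg]; last 2 first.
  + by apply: ad hg hg' _; apply/funext => x; rewrite mulrDr.
  + by apply: sc hg _; apply/funext => x; rewrite mulrCA.
  + apply: (ad _ _ _ (trig_scale (2^-1) (trig_sin (t + s)))
      (trig_scale (2^-1) (trig_sin (t - s)))); apply/funext => x.
    by rewrite mulrBl mulrDl sinB sinD; field.
  + apply: (ad _ _ _ (trig_scale (2^-1) (trig_cos (t - s)))
      (trig_scale (- 2^-1) (trig_cos (t + s)))); apply/funext => x.
    by rewrite mulrBl mulrDl cosB cosD; field.
Qed.

Lemma trig_poly_cst c : trig_poly (fun=> c).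
Proof.
rewrite (_ : (fun=> c) = fun x => c * cos (0 * x)); last first.
  by apply/funext => x; rewrite mul0r cos0 mulr1.
exact/trig_scale/trig_cos.
Qed.

Lemma trig_poly_exp f n : trig_poly f -> trig_poly (fun x => f x ^+ n).
Proof.
move=> tf; elim: n => [|n IH].
  by rewrite (_ : (fun _ => _) = fun=> 1)//; exact: trig_poly_cst.
rewrite (_ : (fun _ => _) = fun x => f x * f x ^+ n); first exact: trig_poly_mul.
by apply/funext => x; rewrite exprS.
Qed.

Lemma trig_poly_Rintegral mu nu f : char_fun mu =1 char_fun nu ->
  trig_poly f -> \int[mu]_x f x = \int[nu]_x f x.
Proof.
move=> mn; elim=> {f} [t|t|f g tf hf tg hg|c f tf hf].
- by case: (mn t).
- by case: (mn t).
- by rewrite !RintegralD ?hf ?hg//; exact: trig_poly_integrable.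
- by rewrite !RintegralZl ?hf//; exact: trig_poly_integrable.
Qed.

End trigonometric_polynomials.

(** * Polynomials approaching a step function on the unit interval *)

Section threshold_polynomials.
Context (R : realType).

(** A pi-system argument: the rays are stable under intersection, generate the Borel sets, and those
    with integer endpoints exhaust the line. *)
Lemma measure_eq_lray (m1 m2 : {measure set R -> \bar R}) :
  (m1 setT < +oo)%E ->
  (forall x, m1 `]-oo, x[%classic = m2 `]-oo, x[%classic) ->
  forall A, measurable A -> m1 A = m2 A.
Proof.
move=> m1oo m12 A mA.
apply: (@measure_unique _ _ _ (@RGenInftyO.G R) (fun n => `]-oo, n%:R[%classic) _ _ _ _ m1 m2) mA.
- exact: RGenInftyO.measurableE.
- move=> _ _ [x ->] [y ->]; exists (Num.min x y).
  by apply/seteqP; split => z; rewrite /= !in_itv/= lt_min => /andP.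
- by move=> n; exists n%:R.
- apply/seteqP; split => // x _; exists (Num.truncn `|x|).+1 => //=.
  by rewrite in_itv/= (le_lt_trans (ler_norm x))// truncnS_gt.
- by move=> _ [x ->]; exact: m12.
- move=> n; apply: le_lt_trans m1oo; apply: le_measure; rewrite ?inE//.
Qed.

(** Because n s^n <= s + ... + s^n, a partial sum of a geometric series. *)
Lemma natr_mul_expr_le (s : R) n : 0 < s < 1 -> n%:R * s ^+ n <= s / (1 - s).
Proof.
move=> /andP[s0 s1]; rewrite ler_pdivlMr ?subr_gt0//.
elim: n => [|n IH]; first by rewrite !mul0r ltW.
have -> : n.+1%:R * s ^+ n.+1 * (1 - s) =
    s * (n%:R * s ^+ n * (1 - s)) + s * ((1 - s) * s ^+ n).
  by rewrite -natr1 exprS; ring.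
rewrite -mulrDr ler_piMr//; first exact: ltW.
have sn : s ^+ n <= 1 by rewrite exprn_ile1// ltW.
(* This is n s^n <= 1 + s + ... + s^(n-1), multiplied by 1 - s. *)
suff : n%:R * s ^+ n * (1 - s) <= 1 - s ^+ n.
  have : 0 <= s * s ^+ n by rewrite -exprS exprn_ge0// ltW.
  lra.
clear IH sn; elim: n => [|n IH]; first by rewrite expr0 !mul0r subrr.
have sn : s ^+ n <= 1 by rewrite exprn_ile1// ltW.
have sn0 : 0 <= s ^+ n by rewrite exprn_ge0// ltW.
rewrite -natr1 exprS; set a := n%:R in IH *; set e := s ^+ n in IH sn sn0 *.
have : s * (a * e * (1 - s)) <= s * (1 - e) by rewrite ler_wpM2l// ltW.
have : 0 <= (1 - s) * (1 - s * e) by rewrite mulr_ge0 ?subr_ge0 ?mulr_ile1// ltW.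
lra.
Qed.

(** Bernoulli's inequality; it controls [threshold] from below, and its companion [exprB1_le]
    controls it from above. *)
Lemma exprB1_ge (a : R) n : 0 <= a <= 1 -> 1 - n%:R * a <= (1 - a) ^+ n.
Proof.
move=> /andP[a0 a1]; elim: n => [|n IH]; first by rewrite expr0 mul0r subr0.
have := ler_wpM2l (_ : 0 <= 1 - a) IH.
rewrite subr_ge0 a1 => /(_ isT); rewrite -exprS; apply: le_trans.
have : 0 <= (n%:R : R) by exact: ler0n.
rewrite -natr1; nra.
Qed.

Lemma exprB1_le (a : R) n : 0 <= a <= 1 -> (1 - a) ^+ n * (1 + n%:R * a) <= 1.
Proof.
move=> /andP[a0 a1]; elim: n => [|n IH]; first by rewrite expr0 mul0r addr0 mulr1.
apply: le_trans IH; rewrite exprSr -mulrA ler_wpM2l ?exprn_ge0 ?subr_ge0//.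
have : 0 <= (n%:R : R) by exact: ler0n.
rewrite -natr1; nra.
Qed.

(* The polynomials used by Brosowski and Deutsch to prove the Stone-Weierstrass
   theorem. *)
Definition threshold n (y : R) := (1 - y ^+ n) ^+ (n * 2 ^ n)%N.

(** The deciding quantity is n 2^n y^n = n (2y)^n: it tends to 0 for y < 1/2 and is at least n for y
    >= 1/2. The extra factor n in the exponent of [threshold] makes the limit 0 at y = 1/2 too. *)
Lemma cvg_threshold (y : R) : 0 <= y <= 1 ->
  threshold n y @[n --> \oo] --> ((y < 2^-1)%R%:R : R).
Proof.
move=> /andP[y0 y1].
have yn n : 0 <= y ^+ n <= 1 by rewrite exprn_ge0// exprn_ile1.
have t0 n : 0 <= threshold n y.
  by rewrite exprn_ge0// subr_ge0; case/andP: (yn n).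
have t1 n : threshold n y <= 1.
  apply: exprn_ile1; first by rewrite subr_ge0; case/andP: (yn n).
  by rewrite gerBl; case/andP: (yn n).
have mE n : (n * 2 ^ n)%N%:R * y ^+ n = n%:R * (2 * y) ^+ n.
  by rewrite natrM natrX exprMn; ring.
case: ltP => y2.
(* The square root leaves a spare factor: n s^(2n) = (n s^n) s^n, whose first factor is bounded. The
   value 1/4 keeps s positive when y = 0. *)
- pose s := Num.sqrt (Num.max (2 * y) (4^-1)).
  have m1 : Num.max (2 * y) 4^-1 < 1.
    by rewrite gt_max; apply/andP; split; lra.
  have m0 : 0 < Num.max (2 * y) 4^-1 by rewrite lt_max; apply/orP; right; lra.
  have s0 : 0 < s by rewrite sqrtr_gt0.
  have s1 : s < 1 by rewrite -sqrtr1 ltr_sqrt.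
  have sE : s ^+ 2 = Num.max (2 * y) 4^-1 by rewrite sqr_sqrtr// ltW.
  have bd n : n%:R * (2 * y) ^+ n <= s / (1 - s) * s ^+ n.
    apply: (@le_trans _ _ (n%:R * (s ^+ 2) ^+ n)).
      rewrite ler_wpM2l// lerXn2r ?nnegrE//; first lra.
        exact: exprn_ge0 (ltW s0).
      by rewrite sE le_max lexx.
    rewrite -exprM mulnC exprM expr2 mulrA ler_wpM2r//.
      by rewrite exprn_ge0// ltW.
    by apply: natr_mul_expr_le; rewrite s0.
  apply: (@squeeze_cvgr _ _ _ _ (fun n => 1 - s / (1 - s) * s ^+ n) (cst 1)).
  + apply/nearW => n; rewrite t1 andbT; apply: le_trans (exprB1_ge _ (yn n)).
    by rewrite mE lerD2l lerN2.
  + rewrite -[X in _ --> X]subr0; apply: cvgB; first exact: cvg_cst.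
    rewrite -[X in _ --> X](mulr0 (s / (1 - s))).
    apply: cvgM; first exact: cvg_cst.
    by apply: cvg_expr; rewrite ger0_norm ?ltW.
  + exact: cvg_cst.
- apply: (@squeeze_cvgr _ _ _ _ (cst 0) (@harmonic R)).
  + apply: nearW => n; rewrite t0 /= -[leRHS]mul1r ler_pdivlMr ?ltr0n//.
    apply: le_trans (exprB1_le (n * 2 ^ n)%N (yn n)); rewrite ler_wpM2l// mE.
    rewrite -natr1 addrC lerD2l ler_peMr// exprn_ege1//; lra.
  + exact: cvg_cst.
  + exact: cvg_harmonic.
Qed.

End threshold_polynomials.

Section char_fun_inj.
Context (R : realType) (mu nu : probability R R).
Hypothesis mn : char_fun mu =1 char_fun nu.

Lemma eq_Rintegral_cvg (f_ : nat -> R -> R) (f : R -> R) (M : R) :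
  (forall n, measurable_fun setT (f_ n)) ->
  (forall n x, `|f_ n x| <= M) -> (forall x, f_ n x @[n --> \oo] --> f x) ->
  (forall n, \int[mu]_x f_ n x = \int[nu]_x f_ n x) ->
  \int[mu]_x f x = \int[nu]_x f x.
Proof.
move=> mf_ fM f_f e.
have mf : measurable_fun setT f by exact: measurable_fun_cvg mf_ (fun x _ => f_f x).
have /cvg_lim <- // := cvg_Rintegral_bounded (P := mu) mf_ mf fM f_f.
under eq_fun do rewrite e.
by have /cvg_lim -> := cvg_Rintegral_bounded (P := nu) mf_ mf fM f_f.
Qed.

(** The trigonometric polynomial [h] is (1 + sin (t (x - c))) / 2. It takes its values in [0, 1] and
    is below 1/2 exactly where the sine is negative, so the functions [threshold n (h x)] converge
    to the integrand. *)
Lemma Rintegral_sin_lt0 (t c : R) :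
  \int[mu]_x ((sin (t * (x - c)) < 0)%R%:R : R) =
  \int[nu]_x ((sin (t * (x - c)) < 0)%R%:R : R).
Proof.
pose h x := 2^-1 + (2^-1 * cos (t * c) * sin (t * x) +
                   (- 2^-1 * sin (t * c)) * cos (t * x)).
have th : trig_poly h.
  apply: (@trig_add _ (fun=> 2^-1)); first exact: trig_poly_cst.
  by apply: trig_add; apply: trig_scale; [exact: trig_sin|exact: trig_cos].
have hE x : h x = 2^-1 + 2^-1 * sin (t * (x - c)) by rewrite /h mulrBr sinB; ring.
have h01 x : 0 <= h x <= 1.
  rewrite hE; have := sin_geN1 (t * (x - c)); have := sin_le1 (t * (x - c)); lra.
have tt n : trig_poly (fun x => threshold n (h x)).
  apply: trig_poly_exp; rewrite (_ : (fun x => _) = fun x => 1 + (-1) * h x ^+ n).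
    apply: (@trig_add _ (fun=> 1)); first exact: trig_poly_cst.
    exact/trig_scale/trig_poly_exp.
  by apply/funext => x; rewrite mulN1r.
apply: (@eq_Rintegral_cvg (fun n x => threshold n (h x)) _ 1).
- by move=> n; exact: trig_poly_measurable.
- move=> n x; case/andP: (h01 x) => h0 h1.
  have hn0 : 0 <= h x ^+ n by rewrite exprn_ge0.
  have hn1 : h x ^+ n <= 1 by rewrite exprn_ile1.
  rewrite ger0_norm ?exprn_ge0 ?subr_ge0//.
  by rewrite exprn_ile1 ?subr_ge0// gerBl.
- move=> x; have := cvg_threshold (h01 x).
  rewrite (_ : (h x < 2^-1) = (sin (t * (x - c)) < 0))//.
  by rewrite hE; apply/idP/idP => ?; lra.
- by move=> n; exact: trig_poly_Rintegral.
Qed.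

Lemma sin_lt0E (y : R) : `|y| < 1 -> (sin y < 0) = (y < 0).
Proof.
move=> y1; have := pi_ge2 R => pi2.
have pos (z : R) : 0 < z -> z < 1 -> 0 < sin z.
  by move=> z0 z1; apply: sin_gt0_pi; rewrite z0 /=; lra.
case: (ltrgtP y 0) => y0.
- rewrite -oppr_gt0 -sinN; apply: pos; rewrite ?oppr_gt0//.
  by move: y1; rewrite ltr0_norm.
- by apply/negbTE; rewrite -leNgt ltW// pos// -(gtr0_norm y0).
- by rewrite y0 sin0 ltxx.
Qed.

(* [sin (t * (x - c)) < 0] becomes [x < c] as t tends to 0. *)
Lemma char_fun_inj A : measurable A -> mu A = nu A.
Proof.
move=> mA; apply: (@measure_eq_lray _ mu nu) mA => [|c].
  by rewrite -ge0_fin_numE// fin_num_measure.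
have key : \int[mu]_x \1_`]-oo, c[%classic x = \int[nu]_x \1_`]-oo, c[%classic x :> R.
  apply: (@eq_Rintegral_cvg
    (fun m x => (sin (m.+1%:R^-1 * (x - c)) < 0)%R%:R) _ 1).
  - move=> m; rewrite (_ : (fun x => _) = \1_[set x | sin (m.+1%:R^-1 * (x - c)) < 0]).
      apply: measurable_indic; rewrite -[X in measurable X]setTI.
      apply: measurable_fun_ltr => //.
      apply: measurableT_comp; first by apply: continuous_measurable_fun; exact: continuous_sin.
      apply: measurable_funM => //; exact: measurable_funB.
    by apply/funext => x; rewrite indicE; case: (ltP (sin _)) => h;
      [rewrite mem_set|rewrite memNset//=; apply/negP; rewrite -leNgt].
  - by move=> m x; case: (_ < 0); rewrite ?normr0 ?normr1.
  - move=> x; apply: (@cvg_near_cst _ _ _ _ _ _).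
    near=> m; rewrite sin_lt0E; last first.
      rewrite normrM gtr0_norm ?invr_gt0// ltr_pdivrMl// mulr1.
      apply: lt_trans (_ : m%:R < _); last by rewrite ltr_nat.
      by near: m; exact: nbhs_infty_gtr.
    rewrite pmulr_rlt0 ?invr_gt0// subr_lt0 indicE.
    by case: ltP => h; [rewrite mem_set|rewrite memNset//= in_itv/= ltNge h].
  - by move=> m; exact: Rintegral_sin_lt0.
have iE (P : probability R R) :
    P `]-oo, c[%classic = (\int[P]_x \1_`]-oo, c[%classic x)%:E :> \bar R.
  by rewrite /Rintegral integral_indic// setIT fineK// fin_num_measure.
exact: etrans (iE mu) (etrans (congr1 EFin key) (esym (iE nu))).
Unshelve. all: end_near. Qed.

End char_fun_inj.

Lemma measurable_preimage d d' (T : measurableType d) (T' : measurableType d')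
    (f : T -> T') A :
  measurable_fun setT f -> measurable A -> measurable (f @^-1` A).
Proof. by move=> mf mA; rewrite -[X in measurable X]setTI; exact: mf. Qed.

(** * Independence and characteristic functions of sums *)

Section independence.
Context d (T : measurableType d) (R : realType) (P : probability T R).

(** Both sides are finite measures in C, the restriction of P to E and P scaled by P(E), and they
    agree on a generating pi-system. *)
Lemma indep_sigma (G : set (set T)) E : setI_closed G -> G `<=` measurable ->
  measurable E -> (forall C, G C -> P (C `&` E) = (P C * P E)%E) ->
  forall C, <<s G >> C -> P (C `&` E) = (P C * P E)%E.
Proof.
move=> GI Gm mE GE.
have PEfin : P E \is a fin_num by rewrite fin_num_measure.
have e0 : 0 <= fine (P E) by rewrite fine_ge0.
pose m1 := mrestr P mE.
pose m2 := mscale (NngNum e0) P.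
have HG : [set X | G X /\ X `<=` setT] = G.
  by apply/seteqP; split => [X []//|X GX]; split.
move=> C sC.
have : m1 C = m2 C.
  apply: (@g_sigma_algebra_measure_unique_trace _ _ _ G setT) => //;
    rewrite ?HG//.
  - change (P (setT `&` E) = (fine (P E))%:E * P setT)%E.
    by rewrite setTI probability_setT mule1 fineK.
  - move=> A GA; change (P (A `&` E) = (fine (P E))%:E * P A)%E.
    by rewrite fineK// muleC GE.
  - change (P (setT `&` E) < +oo)%E.
    by rewrite setTI ltey_eq PEfin.
by rewrite /m1 /m2 /mrestr /mscale/= fineK// muleC.
Qed.

Lemma indep_lray (X : T -> R) E : measurable_fun setT X -> measurable E ->
  (forall x, P (X @^-1` `]-oo, x[ `&` E) = (P (X @^-1` `]-oo, x[) * P E)%E) ->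
  forall A, measurable A -> P (X @^-1` A `&` E) = (P (X @^-1` A) * P E)%E.
Proof.
move=> mX mE h A mA.
apply: (@indep_sigma (preimage_set_system setT X (@RGenInftyO.G R))) => //.
- move=> _ _ [_ [x ->] <-] [_ [y ->] <-].
  exists `]-oo, (Num.min x y)[%classic; first by exists (Num.min x y).
  rewrite !setTI; apply/seteqP; split => z; rewrite /= !in_itv/= lt_min => /andP//.
- by move=> _ [_ [x ->] <-]; rewrite setTI; exact: measurable_preimage.
- by move=> _ [_ [x ->] <-]; rewrite setTI h.
- rewrite g_sigma_preimageE -RGenInftyO.measurableE.
  by exists A => //; rewrite setTI.
Qed.

Definition indep2 (X Y : T -> R) := forall A B, measurable A -> measurable B ->
  P (X @^-1` A `&` Y @^-1` B) = (P (X @^-1` A) * P (Y @^-1` B))%E.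

Lemma indep2_sym (X Y : T -> R) : indep2 X Y -> indep2 Y X.
Proof. by move=> XY A B mA mB; rewrite setIC XY// muleC. Qed.

Lemma indep2_lray (X Y : T -> R) : measurable_fun setT X -> measurable_fun setT Y ->
  (forall x y, P (X @^-1` `]-oo, x[ `&` Y @^-1` `]-oo, y[) =
    (P (X @^-1` `]-oo, x[) * P (Y @^-1` `]-oo, y[))%E) -> indep2 X Y.
Proof.
move=> mX mY h A B mA mB.
apply: indep_lray => // [|x]; first exact: measurable_preimage.
rewrite setIC muleC; apply: indep_lray => // [|y]; first exact: measurable_preimage.
by rewrite setIC muleC.
Qed.

End independence.

Local Open Scope complex_scope.

Section independent_integral.
Context d (T : measurableType d) (R : realType) (P : probability T R).
Implicit Types (X Y : T -> R).

Lemma Rintegral_law X (mu : probability R R) (f : R -> R) M :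
  measurable_fun setT X -> measurable_fun setT f -> (forall x, `|f x| <= M) ->
  (forall A, measurable A -> P (X @^-1` A) = mu A) ->
  \int[P]_w f (X w) = \int[mu]_x f x.
Proof.
move=> mX mf fM XE.
have := @integral_pushforward _ _ _ _ R X mX P setT (EFin \o f).
rewrite preimage_setT => /(_ _ _ measurableT) h.
rewrite /Rintegral -[in LHS]h; [|exact/measurable_EFinP|]; last first.
  by apply: (@bounded_integrable _ _ _ _ (f \o X) M) => [|x]; [exact: measurableT_comp|exact: fM].
congr fine.
apply: (@eq_measure_integral _ _ _ _ mu
  (measure_function_pushforward__canonical__measure_function_Measure P mX)).
by move=> A mA _; exact: XE.
Qed.

(** By uniqueness of product measures, independence identifies the law of (X, Y) with the product of
    the marginal laws; Fubini then separates the integral. *)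
Lemma Rintegral_indep2 X Y (f g : R -> R) M N :
  measurable_fun setT X -> measurable_fun setT Y -> indep2 P X Y ->
  measurable_fun setT f -> measurable_fun setT g ->
  (forall x, `|f x| <= M) -> (forall x, `|g x| <= N) ->
  \int[P]_w (f (X w) * g (Y w)) = \int[P]_w f (X w) * \int[P]_w g (Y w).
Proof.
move=> mX mY XY mf mg fM gN.
have [X' XE] : exists X' : {mfun T >-> R}, X = X'.
  by exists (HB.pack_for {mfun T >-> R} X (isMeasurableFun.Build _ _ _ _ X mX)).
have [Y' YE] : exists Y' : {mfun T >-> R}, Y = Y'.
  by exists (HB.pack_for {mfun T >-> R} Y (isMeasurableFun.Build _ _ _ _ Y mY)).
pose mu : probability R R := distribution P X'.
pose nu : probability R R := distribution P Y'.
rewrite (@Rintegral_law X mu f M)//; last by rewrite XE.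
rewrite (@Rintegral_law Y nu g N)//; last by rewrite YE.
have mXY : measurable_fun setT (fun w => (X w, Y w)) by exact: measurable_fun_pair.
pose F (z : R * R) := f z.1 * g z.2.
have mF : measurable_fun setT F.
  by apply: measurable_funM; apply: measurableT_comp.
have FMN z : `|F z| <= M * N by rewrite normrM ler_pM.
have h := @integral_pushforward _ _ _ _ R _ mXY P setT (EFin \o F).
rewrite preimage_setT in h.
rewrite {1}/Rintegral -[X in fine X]h//; [|exact/measurable_EFinP|]; last first.
  by apply: (@bounded_integrable _ _ _ _ (fun w => F (X w, Y w)) (M * N)) => [|w];
    [exact: (measurableT_comp mF mXY)|exact: FMN].
pose mn : probability (R * R)%type R := (mu \x nu)%E.
rewrite (@eq_measure_integral _ _ _ _ mn
  (measure_function_pushforward__canonical__measure_function_Measure P mXY)); last first.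
  move=> A mA _; apply/esym; apply: product_measure_unique => // B C mB mC.
  have e : P (X @^-1` B `&` Y @^-1` C) = (mu B * nu C)%E by rewrite XY// XE YE.
  exact: e.
rewrite -integral12_prod_meas1; last exact: (@bounded_integrable _ _ _ mn F (M * N)).
have fi : mu.-integrable setT (EFin \o f) by exact: bounded_integrable fM.
have gi : nu.-integrable setT (EFin \o g) by exact: bounded_integrable gN.
rewrite -RintegralZr// /Rintegral; congr fine; apply: eq_integral => x _.
rewrite /fubini_F /F/= (eq_integral (fun y => (f x)%:E * (g y)%:E)%E)//.
rewrite integralZl// EFinM; congr (_ * _)%E.
by rewrite fineK//; exact: integrable_fin_num.
Qed.

End independent_integral.

Section char_fun_rv.
Context d (T : measurableType d) (R : realType) (P : probability T R).
Implicit Types (X Y : T -> R) (t : R).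

(** Defined for a bare function, so that sums and products of random variables need no bundling;
    [cf_law] links it to [char_fun]. *)
Definition cf X t : R[i] :=
  (\int[P]_w cos (t * X w)) +i* (\int[P]_w sin (t * X w)).

Lemma Rintegral_probability_cst (c : R) : \int[P]_w c = c.
Proof. by rewrite Rintegral_cst// [X in fine X](probability_setT P) mulr1. Qed.

Lemma cos_bound (x : R) : `|cos x| <= 1.
Proof. by rewrite ler_norml cos_geN1 cos_le1. Qed.

Lemma sin_bound (x : R) : `|sin x| <= 1.
Proof. by rewrite ler_norml sin_geN1 sin_le1. Qed.

Lemma cf_law X (mu : probability R R) t : measurable_fun setT X ->
  (forall A, measurable A -> P (X @^-1` A) = mu A) -> cf X t = char_fun mu t.
Proof.
move=> mX XE; rewrite /cf /char_fun; congr (_ +i* _).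
- apply: (@Rintegral_law _ _ _ P X mu (fun x => cos (t * x)) 1) => //.
    exact: measurable_cos_lin.
  by move=> x; exact: cos_bound.
- apply: (@Rintegral_law _ _ _ P X mu (fun x => sin (t * x)) 1) => //.
    exact: measurable_sin_lin.
  by move=> x; exact: sin_bound.
Qed.

Lemma cf_scale X (b t : R) : cf (fun w => b * X w) t = cf X (b * t).
Proof.
by rewrite /cf; congr (_ +i* _); apply: eq_Rintegral => w _; congr (_ _); ring.
Qed.

Lemma integrable_cos X t : measurable_fun setT X ->
  P.-integrable setT (EFin \o (fun w => cos (t * X w))).
Proof.
move=> mX; apply: (@bounded_integrable _ _ _ P (fun w => cos (t * X w)) 1).
  exact: measurableT_comp (measurable_cos_lin t) mX.
by move=> w; exact: cos_bound.
Qed.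

Lemma integrable_sin X t : measurable_fun setT X ->
  P.-integrable setT (EFin \o (fun w => sin (t * X w))).
Proof.
move=> mX; apply: (@bounded_integrable _ _ _ P (fun w => sin (t * X w)) 1).
  exact: measurableT_comp (measurable_sin_lin t) mX.
by move=> w; exact: sin_bound.
Qed.

Lemma cf_add X Y t : measurable_fun setT X -> measurable_fun setT Y ->
  indep2 P X Y -> cf (fun w => X w + Y w) t = cf X t * cf Y t.
Proof.
move=> mX mY XY.
have tr (f g : R -> R) : (forall x, `|f x| <= 1) -> (forall x, `|g x| <= 1) ->
    continuous f -> continuous g ->
    \int[P]_w (f (t * X w) * g (t * Y w)) =
    \int[P]_w f (t * X w) * \int[P]_w g (t * Y w) /\
    P.-integrable setT (EFin \o (fun w => f (t * X w) * g (t * Y w))).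
  move=> f1 g1 cf cg.
  have mf : measurable_fun setT (fun x => f (t * x)).
    by apply: measurableT_comp; [exact: continuous_measurable_fun|exact: measurable_funM].
  have mg : measurable_fun setT (fun x => g (t * x)).
    by apply: measurableT_comp; [exact: continuous_measurable_fun|exact: measurable_funM].
  split.
    exact: (@Rintegral_indep2 _ _ _ _ X Y (fun x => f (t * x)) (fun x => g (t * x)) 1 1).
  apply: (@bounded_integrable _ _ _ P _ (1 * 1)) => [|w].
    by apply: measurable_funM; [exact: measurableT_comp mf mX|exact: measurableT_comp mg mY].
  by rewrite normrM ler_pM.
have [cc cci] := tr cos cos cos_bound cos_bound (@continuous_cos R) (@continuous_cos R).
have [cs csi] := tr cos sin cos_bound sin_bound (@continuous_cos R) (@continuous_sin R).
have [sc sci] := tr sin cos sin_bound cos_bound (@continuous_sin R) (@continuous_cos R).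
have [ss ssi] := tr sin sin sin_bound sin_bound (@continuous_sin R) (@continuous_sin R).
have -> : cf X t * cf Y t =
    (\int[P]_w cos (t * X w) * \int[P]_w cos (t * Y w) -
     \int[P]_w sin (t * X w) * \int[P]_w sin (t * Y w)) +i*
    (\int[P]_w cos (t * X w) * \int[P]_w sin (t * Y w) +
     \int[P]_w sin (t * X w) * \int[P]_w cos (t * Y w)) by [].
rewrite -cc -cs -sc -ss -RintegralB// -RintegralD//; congr (_ +i* _).
- by apply: eq_Rintegral => w _; rewrite mulrDr cosD.
- by apply: eq_Rintegral => w _; rewrite mulrDr sinD addrC.
Qed.

Lemma cf_ae_eq X Y t : measurable_fun setT X -> measurable_fun setT Y ->
  {ae P, forall w, X w = Y w} -> cf X t = cf Y t.
Proof.
move=> mX mY XY; rewrite /cf /Rintegral; congr (fine _ +i* fine _).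
- apply: ae_eq_integral => //.
  + exact: measurable_int (integrable_cos t mX).
  + exact: measurable_int (integrable_cos t mY).
  + by apply: filterS XY => w /= -> _.
- apply: ae_eq_integral => //.
  + exact: measurable_int (integrable_sin t mX).
  + exact: measurable_int (integrable_sin t mY).
  + by apply: filterS XY => w /= -> _.
Qed.

(** As I takes only the values 0 and 1, exp (i t I E) = (1 - I) + I exp (i t E). *)
Lemma cf_bernoulli_mul (I E : T -> R) (p t : R) :
  measurable_fun setT I -> measurable_fun setT E -> indep2 P I E ->
  (forall w, I w = 0 \/ I w = 1) -> P [set w | I w = 1] = (1 - p)%:E ->
  cf (fun w => I w * E w) t = p%:C + (1 - p)%:C * cf E t.
Proof.
move=> mI mE IE I01 I1.
(* On the values of [I] this agrees with the identity, but it is bounded on the whole line, as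
   [Rintegral_indep2] requires. *)
pose f (x : R) := \1_[set (1 : R)] x : R.
have mf : measurable_fun setT f by exact: measurable_indic.
have f1 x : `|f x| <= 1 by rewrite /f indicE; case: (_ \in _); rewrite ?normr0 ?normr1.
have fI w : f (I w) = I w.
  rewrite /f indicE; case: (I01 w) => ->; last by rewrite mem_set.
  by rewrite memNset//= => /esym/eqP; rewrite oner_eq0.
have mfI : measurable_fun setT (fun w => f (I w)) by exact: measurableT_comp.
have intI : \int[P]_w f (I w) = 1 - p.
  rewrite (_ : (fun w => f (I w)) = \1_[set w | I w = 1]); last first.
    by apply/funext => w; rewrite /f !indicE; congr (_%:R);
      apply/idP/idP => /set_mem h; apply/mem_set.
  have mI1 : measurable [set w | I w = 1].
    by apply: (@measurable_preimage _ _ _ _ I [set 1]).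
  by rewrite /Rintegral integral_indic// setIT; apply: etrans (congr1 fine I1) _.
have intfI : P.-integrable setT (EFin \o (fun w => f (I w))).
  exact: (@bounded_integrable _ _ _ P _ 1).
have i1 : P.-integrable setT (EFin \o (fun w => 1 - f (I w))).
  apply: (@bounded_integrable _ _ _ P _ 1); first exact: measurable_funB.
  by move=> w; rewrite fI; case: (I01 w) => ->; rewrite ?subr0 ?subrr ?normr0 ?normr1.
have ic : P.-integrable setT (EFin \o (fun w => f (I w) * cos (t * E w))).
  apply: (@bounded_integrable _ _ _ P _ (1 * 1)).
    by apply: measurable_funM => //; exact: measurableT_comp (measurable_cos_lin t) mE.
  by move=> w; rewrite normrM ler_pM// cos_bound.
have c : \int[P]_w cos (t * (I w * E w)) = p + (1 - p) * \int[P]_w cos (t * E w).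
  rewrite (@eq_Rintegral _ _ _ _ _ (fun w => (1 - f (I w)) + f (I w) * cos (t * E w)));
    last first.
    move=> w _; rewrite fI; case: (I01 w) => ->.
      by rewrite mul0r mulr0 cos0 mul0r subr0 addr0.
    by rewrite !mul1r subrr add0r.
  rewrite RintegralD// (@RintegralB _ _ _ _ _ (fun=> 1))//; last first.
    by apply: (@bounded_integrable _ _ _ P (fun=> 1) 1) => // w; rewrite normr1.
  rewrite Rintegral_probability_cst intI.
  rewrite (@Rintegral_indep2 _ _ _ P I E f (fun x => cos (t * x)) 1 1)//.
  - by rewrite intI /=; ring.
  - exact: measurable_cos_lin.
  - by move=> x; exact: cos_bound.
have s : \int[P]_w sin (t * (I w * E w)) = (1 - p) * \int[P]_w sin (t * E w).
  rewrite (@eq_Rintegral _ _ _ _ _ (fun w => f (I w) * sin (t * E w))); last first.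
    move=> w _; rewrite fI; case: (I01 w) => ->.
      by rewrite mul0r mulr0 sin0 mul0r.
    by rewrite !mul1r.
  rewrite (@Rintegral_indep2 _ _ _ P I E f (fun x => sin (t * x)) 1 1)//.
  - by rewrite intI /=; ring.
  - exact: measurable_sin_lin.
  - by move=> x; exact: sin_bound.
rewrite /cf c s; apply/eqP; rewrite eq_complex /=; apply/andP; split; apply/eqP; ring.
Qed.

(** What remains to be seen is that X is independent of the product I E. An event on I E splits
    according to the value of I, and the triple product rule applies to each piece. *)
Lemma cf_AR1 X (I E : T -> R) (b p t : R) :
  measurable_fun setT X -> measurable_fun setT I -> measurable_fun setT E ->
  (forall A B C, measurable A -> measurable B -> measurable C ->
    P (I @^-1` A `&` E @^-1` B `&` X @^-1` C) =
    (P (I @^-1` A) * P (E @^-1` B) * P (X @^-1` C))%E) ->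
  (forall w, I w = 0 \/ I w = 1) -> P [set w | I w = 1] = (1 - p)%:E ->
  cf (fun w => b * X w + I w * E w) t =
    cf X (b * t) * (p%:C + (1 - p)%:C * cf E t).
Proof.
move=> mX mI mE h I01 I1.
have IE : indep2 P I E.
  move=> A B mA mB; have := h A B setT mA mB measurableT.
  by rewrite preimage_setT setIT probability_setT mule1.
rewrite -(cf_bernoulli_mul t mI mE IE I01 I1) -cf_scale.
apply: cf_add; [exact: measurable_funM|exact: measurable_funM|].
suff XIE : indep2 P X (fun w => I w * E w).
  move=> A B mA mB; apply: (XIE ((fun x => b * x) @^-1` A)) => //.
  by apply: measurable_preimage => //; exact: measurable_funM.
apply: indep2_sym => B C mB mC.
pose I0 := I @^-1` [set 0 : R]; pose I1' := I @^-1` [set 1 : R].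
pose D := (fun w => I w * E w) @^-1` B.
have mI0 : measurable I0 by apply: measurable_preimage.
have mI1 : measurable I1' by apply: measurable_preimage.
have mXC : measurable (X @^-1` C) by exact: measurable_preimage mX _.
have mEB : measurable (E @^-1` B) by exact: measurable_preimage mE _.
(* Everything or nothing, according to whether 0 lies in B; written as a preimage by E so that [h]
   applies to the piece I = 0 as well. *)
pose Z := E @^-1` [set _ : R | B 0].
have mZ0 : measurable [set _ : R | B 0].
  case: (pselect (B 0)) => b0.
    by rewrite (_ : [set _ | _] = setT)//; apply/seteqP; split.
  by rewrite (_ : [set _ | _] = set0)//; apply/seteqP; split.
have mZ : measurable Z by apply: measurable_preimage.
have DE : D = (I0 `&` Z) `|` (I1' `&` E @^-1` B).
  apply/seteqP; split => w.
    rewrite /D /I0 /I1' /Z /=; case: (I01 w) => ->; rewrite ?mul0r ?mul1r => Bw; by [left|right].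
  by rewrite /D /I0 /I1' /Z /= => -[[->]|[->]]; rewrite ?mul0r ?mul1r.
have sp (F : set T) : measurable F -> P (D `&` F) =
    (P (I0 `&` Z `&` F) + P (I1' `&` E @^-1` B `&` F))%E.
  move=> mF; rewrite DE setIUl; apply: measureU.
  - by apply: measurableI => //; exact: measurableI.
  - by apply: measurableI => //; exact: measurableI.
  - apply/seteqP; split => // w [[[a _] _] [[c _] _]]; move: a c.
    by rewrite /I0 /I1' /= => -> /esym/eqP; rewrite oner_eq0.
rewrite -/D sp// -[X in (_ = P X * _)%E]setIT sp// !setIT.
rewrite (h [set 0] [set _ | B 0] C)// (h [set 1] B C)// (IE [set 0])// (IE [set 1])//.
by rewrite ge0_muleDl//; apply: mule_ge0.
Qed.

End char_fun_rv.

Section independent_sums.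
Context d (T : measurableType d) (R : realType) (P : probability T R).
Context (J : choiceType) (D : set J) (X : J -> {RV P >-> R}).
Hypothesis indX : mutually_independent D X.

Lemma mutually_independent_seq (s : seq J) (A : J -> set R) :
  uniq s -> (forall j, j \in s -> D j) -> (forall j, measurable (A j)) ->
  P (\bigcap_(j in [set` s]) X j @^-1` A j) = (\prod_(j <- s) P (X j @^-1` A j))%E.
Proof.
move=> us sD mA.
have -> : [set` s] = [set` [fset j in s]%fset].
  by apply/seteqP; split => j /=; rewrite !inE.
rewrite indX//; last by move=> j /=; rewrite inE => /sD.
apply: perm_big; apply: uniq_perm => //.
by move=> j; rewrite inE.
Qed.

(** The boxes in the variables indexed by s form a pi-system independent of [X i], and the sum over
    s is measurable for the sigma-algebra that they generate. *)
Lemma indep2_sum (s : seq J) i : uniq (i :: s) -> (forall j, j \in i :: s -> D j) ->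
  indep2 P (fun w => \sum_(j <- s) X j w) (X i).
Proof.
move=> us sD A B mA mB.
have mXB : measurable (X i @^-1` B) by exact: measurable_preimage.
pose G : set (set T) := [set C | exists F : J -> set R, (forall j, measurable (F j)) /\
  C = \bigcap_(j in [set` s]) X j @^-1` F j].
have Gm : G `<=` measurable.
  move=> _ [F [mF ->]]; apply: fin_bigcap_measurable => [|j _]; first exact: finite_seq.
  exact: measurable_preimage.
apply: (@indep_sigma _ _ _ P G) => //.
- move=> _ _ [F [mF ->]] [F' [mF' ->]]; exists (fun j => F j `&` F' j); split.
    by move=> j; exact: measurableI.
  by rewrite -bigcapI; apply: eq_bigcapr => j _; rewrite preimage_setI.
- move=> _ [F [mF ->]].
  have [is' us'] : i \notin s /\ uniq s by move: us => /= /andP.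
  pose F' j := if j == i then B else F j.
  have mF' j : measurable (F' j) by rewrite /F'; case: ifP.
  have FF' : {in s, F' =1 F}.
    by move=> j js; rewrite /F'; case: eqP => // ji; rewrite -ji js in is'.
  rewrite (mutually_independent_seq us')//; last first.
    by move=> j js; apply: sD; rewrite inE js orbT.
  rewrite -[in RHS](_ : \prod_(j <- s) P (X j @^-1` F' j) =
      \prod_(j <- s) P (X j @^-1` F j))%E; last first.
    by rewrite big_seq [RHS]big_seq; apply: eq_bigr => j js; rewrite FF'.
  rewrite muleC.
  have := mutually_independent_seq us sD mF'.
  rewrite big_cons {2}/F' eqxx => <-; congr (P _).
  apply/seteqP; split => w.
    move=> [h Xw] j /=; rewrite inE => /orP[/eqP ->|js].
      by rewrite /= /F' eqxx.
    by rewrite /= FF'//; exact: h.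
  move=> h; split; last by have := h i; rewrite /= inE eqxx /F' eqxx; apply.
  by move=> j js; have := h j; rewrite /= inE js orbT FF'//; apply.
- pose TG := g_sigma_algebraType G.
  have mX j : j \in s -> measurable_fun (setT : set TG) (X j : TG -> R).
    move=> js _ B' mB'; rewrite setTI; apply: sub_sigma_algebra.
    exists (fun j' => if j' == j then B' else setT); split.
      by move=> j'; case: ifP.
    apply/seteqP; split => w.
      by move=> Xw j' _ /=; case: eqP => // ->.
    by move=> /(_ j js); rewrite /= eqxx.
  have mS : measurable_fun (setT : set TG) (fun w : TG => \sum_(j <- s) X j w).
    have : {subset s <= s} by [].
    elim: {1 3}s => [|j r IH] rs.
      rewrite (_ : (fun w => _) = cst 0); first exact: measurable_cst.
      by apply/funext => w; rewrite big_nil.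
    rewrite (_ : (fun w => _) = fun w => X j w + \sum_(j <- r) X j w); last first.
      by apply/funext => w; rewrite big_cons.
    apply: measurable_funD; first by apply: mX; apply: rs; rewrite inE eqxx.
    by apply: IH => j' jr; apply: rs; rewrite inE jr orbT.
  by have := mS measurableT A mA; rewrite setTI.
Qed.

Lemma cf_sum (s : seq J) t : uniq s -> (forall j, j \in s -> D j) ->
  cf P (fun w => \sum_(j <- s) X j w) t = \prod_(j <- s) cf P (X j) t.
Proof.
elim: s => [|i s IH] us sD.
  rewrite big_nil /cf.
  under eq_Rintegral do rewrite big_nil mulr0 cos0.
  under [X in _ +i* X]eq_Rintegral do rewrite big_nil mulr0 sin0.
  by rewrite !Rintegral_probability_cst.
rewrite big_cons -IH; first last.
- by move=> j js; apply: sD; rewrite inE js orbT.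
- by case/andP: us.
rewrite mulrC -cf_add//.
- congr (cf P _ t); apply/funext => w; rewrite big_cons addrC//.
- exact: measurable_sum.
- exact: indep2_sum.
Qed.

End independent_sums.

Lemma cf_sum_iid d (T : measurableType d) (R : realType) (P : probability T R) k
    (X : 'I_k -> {RV P >-> R}) (mu : probability R R) t :
  mutually_independent setT X -> (forall i, has_law (X i) mu) ->
  cf P (fun w => \sum_(i < k) X i w) t = char_fun mu t ^+ k.
Proof.
move=> indX Xmu; rewrite (cf_sum (D := setT))//; last exact: index_enum_uniq.
rewrite (eq_bigr (fun=> char_fun mu t)) => [|i _].
  by rewrite prodr_const card_ord.
by apply: cf_law => // A mA; exact: Xmu.
Qed.

Lemma norm_complex_le (R : realType) (x y : R) : `|x +i* y| <= (`|x| + `|y|)%:C.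
Proof.
rewrite normc_def /= lecR -[leRHS]ger0_norm ?addr_ge0// -sqrtr_sqr ler_wsqrtr//.
by rewrite sqrrD !real_normK ?num_real// -addrA lerD2l lerDr mulrn_wge0 ?mulr_ge0.
Qed.

(** * From the AR(1) equation to the Laplace form *)

Section char_fun_regularity.
Context (R : realType) (mu : probability R R).
Implicit Types t x : R.

Lemma char_fun0 : char_fun mu 0 = 1.
Proof.
rewrite /char_fun.
under eq_Rintegral do rewrite mul0r cos0.
under [X in _ +i* X]eq_Rintegral do rewrite mul0r sin0.
by rewrite !Rintegral_probability_cst.
Qed.

Lemma continuous_Rintegral_bounded (f : R -> R) : continuous f ->
  (forall x, `|f x| <= 1) -> continuous (fun t => \int[mu]_x f (t * x)).
Proof.
move=> cf f1 t; apply/(@cvg_nbhsP _ R^o) => u ut.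
apply: (@cvg_Rintegral_bounded _ _ _ mu (fun n x => f (u n * x)) (fun x => f (t * x)) 1).
- move=> n; apply: measurableT_comp; first exact: continuous_measurable_fun.
  exact: measurable_funM.
- by apply: measurableT_comp; [exact: continuous_measurable_fun|exact: measurable_funM].
- by [].
- move=> x; apply: (@cvg_comp _ _ _ (fun n => u n * x) f _ (nbhs (t * x))).
    by apply: cvgM => //; exact: cvg_cst.
  exact: cf.
Qed.

Lemma continuous_char_fun : continuous (char_fun mu : R -> (R[i])^o).
Proof.
move=> t; apply/cvgrPdist_lt => e e0.
have [er eE] : exists er : R, e = er%:C.
  by exists (complex.Re e); rewrite RRe_real// gtr0_real.
have er0 : 0 < er by move: e0; rewrite eE ltcR.
have er2 : 0 < er / 2 by rewrite divr_gt0.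
have /(_ t)/cvgrPdist_lt/(_ _ er2) hc :=
  continuous_Rintegral_bounded (@continuous_cos R) (@cos_bound R).
have /(_ t)/cvgrPdist_lt/(_ _ er2) hs :=
  continuous_Rintegral_bounded (@continuous_sin R) (@sin_bound R).
near=> s.
have cs : `|\int[mu]_x cos (t * x) - \int[mu]_x cos (s * x)| < er / 2 by near: s.
have ss : `|\int[mu]_x sin (t * x) - \int[mu]_x sin (s * x)| < er / 2 by near: s.
rewrite eE; apply: le_lt_trans (norm_complex_le _ _) _; rewrite ltcR; lra.
Unshelve. all: end_near. Qed.

(** If c + i s is the value at t, then c^2 + s^2 is the integral of c cos (t x) + s sin (t x), which
    is at most (c^2 + s^2 + 1) / 2 pointwise. *)
Lemma norm_char_fun_le1 t : `|char_fun mu t| <= 1.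
Proof.
rewrite normc_def /char_fun /=; set c := Rintegral _ _ _; set s := Rintegral _ _ _.
rewrite -[1](_ : 1%:C = 1)// lecR -sqrtr1 ler_wsqrtr//.
have ci := integrable_cos mu t (@measurable_id _ _ setT).
have si := integrable_sin mu t (@measurable_id _ _ setT).
have c1 : mu.-integrable setT (EFin \o (fun x => c * cos (t * x))) by exact: (integrableZl measurableT c ci).
have s1 : mu.-integrable setT (EFin \o (fun x => s * sin (t * x))) by exact: (integrableZl measurableT s si).
have cs : mu.-integrable setT (EFin \o (fun x => c * cos (t * x) + s * sin (t * x))).
  exact: (integrableD measurableT c1 s1).
have : \int[mu]_x (c * cos (t * x) + s * sin (t * x)) <=
    \int[mu]_x ((c ^+ 2 + s ^+ 2 + 1) / 2).
  apply: le_Rintegral => //.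
    exact: (@bounded_integrable _ _ _ mu (fun=> (c ^+ 2 + s ^+ 2 + 1) / 2)
      `|(c ^+ 2 + s ^+ 2 + 1) / 2|).
  move=> x _; have := cos2Dsin2 (t * x).
  have := sqr_ge0 (c - cos (t * x)); have := sqr_ge0 (s - sin (t * x)).
  by rewrite !sqrrB; lra.
by rewrite Rintegral_probability_cst RintegralD// !RintegralZl// -/c -/s -!expr2; lra.
Qed.

End char_fun_regularity.

(** By the mean value theorem sin u = u cos c for some c between 0 and u, and the cosine decreases
    on [0, 1]. *)
Lemma sin_ge_lin (R : realType) (u : R) : 0 <= u <= 1 -> cos 1 * u <= sin u.
Proof.
move=> /andP[u0 u1]; move: u0; rewrite le_eqVlt => /predU1P[<-|u0].
  by rewrite mulr0 sin0.
have dsin x : x \in `]0, u[ -> is_derive x 1 sin (cos x).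
  by move=> _; exact: is_derive_sin.
have csin : {within `[0, u], continuous sin}.
  by apply: continuous_subspaceT; exact: continuous_sin.
have [c cu] := MVT u0 dsin csin.
rewrite sin0 !subr0 => ->; rewrite ler_wpM2r ?(ltW u0)//.
move: cu; rewrite in_itv/= => /andP[c0 cu].
have := pi_ge2 R => pi2.
by rewrite ltW// ltr_cos ?(lt_le_trans cu)// in_itv/= ?ler01 ?(ltW c0)/=; lra.
Qed.

(** Since 1 - cos y = 2 sin (y / 2)^2, the constant comes from [sin_ge_lin] at |y| / 2. *)
Lemma one_sub_cos_ge (R : realType) (y : R) : `|y| <= 1 ->
  cos 1 ^+ 2 / 2 * y ^+ 2 <= 1 - cos y.
Proof.
move=> y1; rewrite -(cos_norm y) -(real_normK (num_real y)).
set u := `|y|; have u0 : 0 <= u by exact: normr_ge0.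
have -> : u = (u / 2) *+ 2 by rewrite -mulr_natr; lra.
rewrite cos_mulr2n (cos2sin2 (u / 2)).
have s : cos 1 * (u / 2) <= sin (u / 2) by apply: sin_ge_lin; move: u0 (y1 : u <= 1); lra.
have : (cos 1 * (u / 2)) ^+ 2 <= sin (u / 2) ^+ 2.
  have c1 := cos1_gt0 R.
  have cu : 0 <= cos 1 * (u / 2) by rewrite mulr_ge0 ?(ltW c1) ?divr_ge0.
  by rewrite lerXn2r ?nnegrE// (le_trans cu).
set c := cos 1; set w := sin _;
have -> : 1 - ((1 - w ^+ 2) *+ 2 - 1) = 2 * w ^+ 2 by ring.
have -> : ((u / 2) *+ 2) ^+ 2 = 4 * (u / 2) ^+ 2 by ring.
rewrite exprMn; lra.
Qed.

(** * Decay faster than b^(2 n) leaves only the Dirac mass at 0 *)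

Section fast_decay.
Context (R : realType) (mu : probability R R) (k : nat).
Variables (b p : R) (psi1 : R[i]).
Hypotheses (k0 : (0 < k)%N) (b01 : 0 < b < 1) (p01 : 0 < p < 1).
(** For f = 1 / (1 + psi) this is psi (b^n) = p^n psi 1, with [psi1] standing for psi 1. *)
Hypothesis fE : forall n, 1 - char_fun mu (b ^+ n) ^+ k =
  (p ^+ n)%:C * psi1 * char_fun mu (b ^+ n) ^+ k.

Let phi n := char_fun mu (b ^+ n).

Lemma norm_one_sub_expr (z : R[i]) j : `|z| <= 1 -> `|1 - z ^+ j| <= j%:R * `|1 - z|.
Proof.
move=> z1; elim: j => [|j IH]; first by rewrite expr0 subrr normr0 mul0r.
have -> : 1 - z ^+ j.+1 = (1 - z ^+ j) + z ^+ j * (1 - z) by rewrite exprSr; ring.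
rewrite (le_trans (ler_normD _ _))// -natr1 mulrDl mul1r lerD// normrM normrX.
by rewrite ler_piMl// exprn_ile1.
Qed.

Let cvg_b : b ^+ n @[n --> \oo] --> 0.
Proof. by apply: cvg_expr; case/andP: b01 => b0 b1; rewrite ger0_norm// ltW. Qed.

(** [fE] bounds 1 - z^k for z = [phi n], and 1 - z^k is 1 - z times the sum of the z^j, j < k. As z
    tends to 1 by continuity, that sum stays away from 0. *)
Lemma char_fun_sub_one_le : \forall n \near \oo,
  1 - complex.Re (phi n) <= 2 * complex.Re `|psi1| * p ^+ n.
Proof.
(* If |1 - z| < 1 / (2 k), the sum of the z^j is within k k |1 - z| <= k / 2 of k, hence of modulus
   at least k / 2 >= 1/2. *)
have kk : 0 < ((2 * k%:R)^-1 : R) by rewrite invr_gt0 mulr_gt0// ltr0n.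
have cphi : phi n @[n --> \oo] --> (1 : (R[i])^o).
  rewrite -(char_fun0 mu); apply: (@cvg_comp _ _ _ (fun n => b ^+ n)
    (char_fun mu : R -> (R[i])^o) _ _ _ cvg_b).
  exact: continuous_char_fun.
have kkC : 0 < ((2 * k%:R)^-1)%:C :> R[i] by rewrite ltcR.
have := (cvgrPdist_lt (phi : nat -> (R[i])^o) (1 : (R[i])^o)).1 cphi _ kkC.
move=> near1; near=> n.
have dn : `|1 - phi n| < ((2 * k%:R)^-1)%:C by near: n; exact: near1.
have zn := norm_char_fun_le1 mu (b ^+ n); rewrite -/(phi n) in zn.
have e1 := fE n; rewrite -/(phi n) in e1.
set z := phi n in dn zn e1 *.
have sumE : 1 - z ^+ k = (1 - z) * \sum_(j < k) z ^+ j.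
  by have := subrX1 z k; move/(congr1 -%R); rewrite opprB -mulNr opprB.
have sumge : 2^-1 <= `|\sum_(j < k) z ^+ j|.
  have dif : `|k%:R - \sum_(j < k) z ^+ j| <= k%:R * (k%:R * `|1 - z|).
    have -> : k%:R - \sum_(j < k) z ^+ j = \sum_(j < k) (1 - z ^+ j).
      by rewrite sumrB sumr_const card_ord.
    rewrite (le_trans (ler_norm_sum _ _ _))//.
    rewrite [leRHS](_ : _ = \sum_(j < k) (k%:R * `|1 - z|)); last first.
      by rewrite sumr_const card_ord mulr_natl.
    apply: ler_sum => j _; rewrite (le_trans (norm_one_sub_expr _ _))//.
    by rewrite ler_wpM2r// ler_nat ltnW.
  have kd : k%:R * (k%:R * `|1 - z|) <= k%:R * 2^-1.
    rewrite ler_wpM2l// -ler_pdivlMl ?ltr0n//.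
    apply: le_trans (ltW dn) _.
    by rewrite fmorphV rmorphM /= !rmorph_nat invfM mulrC.
  have h : (k%:R : R[i]) <=
      `|k%:R - \sum_(j < k) z ^+ j| + `|\sum_(j < k) z ^+ j|.
    have := ler_normD (k%:R - \sum_(j < k) z ^+ j) (\sum_(j < k) z ^+ j).
    by rewrite subrK normr_nat.
  have k1 : (1 : R[i]) <= k%:R by rewrite ler1n.
  have h2 : (k%:R : R[i]) <= k%:R * 2^-1 + `|\sum_(j < k) z ^+ j|.
    apply: le_trans h _; rewrite lerD2r; exact: le_trans dif kd.
  have : k%:R * 2^-1 <= `|\sum_(j < k) z ^+ j|.
    by rewrite -(lerD2l (k%:R * 2^-1)) (le_trans _ h2)// -mulrDr -div1r -splitr mulr1.
  by apply: le_trans; rewrite -[leLHS]mul1r ler_wpM2r.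
have main : `|1 - z| <= 2 * `|psi1| * (p ^+ n)%:C.
  have : `|1 - z| * 2^-1 <= (p ^+ n)%:C * `|psi1|.
    apply: (@le_trans _ _ `|1 - z ^+ k|).
      by rewrite sumE normrM ler_wpM2l.
    have p0 : 0 <= p by case/andP: p01 => /ltW.
    have pn : `|(p ^+ n)%:C| = (p ^+ n)%:C by rewrite ger0_norm// ler0c exprn_ge0.
    rewrite e1 !normrM normrX pn ler_piMr ?exprn_ile1// mulr_ge0//.
    by rewrite ler0c exprn_ge0.
  rewrite ler_pdivrMr// => h; apply: le_trans h _.
  by rewrite le_eqVlt; apply/orP; left; apply/eqP; ring.
have psiR : `|psi1| = (complex.Re `|psi1|)%:C by rewrite RRe_real// normr_real.
have : (1 - complex.Re z)%:C <= (2 * complex.Re `|psi1| * p ^+ n)%:C.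
  apply: le_trans (_ : `|1 - z| <= _).
    rewrite normc_def lecR; apply: le_trans (ler_norm _) _.
    rewrite -sqrtr_sqr ler_wsqrtr//.
    by case: (z) => x y /=; rewrite lerDl sqr_ge0.
  by rewrite (le_trans main)// 2!rmorphM /= -psiR rmorph_nat.
by rewrite lecR.
Unshelve. all: end_near. Qed.

Hypothesis pb : p < b ^+ 2.

(** The annuli exhaust the complement of 0. The inner radius bounds x^2 from below, and the outer
    one brings b^n x into [-1, 1], where [one_sub_cos_ge] applies, once n is large. *)
Let annulus m : set R := [set x | m.+1%:R^-1 <= `|x| <= m.+1%:R].

Let annulusE m : annulus m =
  (fun x : R => `|x|) @^-1` `[m.+1%:R^-1, m.+1%:R]%classic.
Proof. by apply/seteqP; split => x /=; rewrite in_itv. Qed.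

Let measurable_annulus m : measurable (annulus m).
Proof.
by rewrite annulusE; apply: measurable_preimage.
Qed.

(* On the annulus, [1 - cos (b ^+ n * x)] is at least a constant times
   [b ^+ (2 * n)], so the measure of the annulus is O((p / b ^+ 2) ^+ n). *)
Let annulus0 m : mu (annulus m) = 0%E.
Proof.
have [b0 b1] := andP b01; have [p0 p1] := andP p01.
have muf : mu (annulus m) \is a fin_num by rewrite fin_num_measure.
pose a := fine (mu (annulus m)).
have a0 : 0 <= a by exact: fine_ge0.
pose c : R := cos 1 ^+ 2 / 2 * m.+1%:R^-1 ^+ 2.
have c0 : 0 < c by rewrite mulr_gt0 ?exprn_gt0 ?invr_gt0// divr_gt0// exprn_gt0 ?cos1_gt0.
pose C := 2 * complex.Re `|psi1|.
have smallb : \forall n \near \oo, b ^+ n < m.+1%:R^-1.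
  have m1 : 0 < (m.+1%:R^-1 : R) by rewrite invr_gt0.
  have := (cvgrPdist_lt _ _).1 cvg_b _ m1; move=> h; near=> n.
  have : `|0 - b ^+ n| < m.+1%:R^-1 by near: n; exact: h.
  by rewrite sub0r normrN ger0_norm// exprn_ge0// ltW.
have bound : \forall n \near \oo, a <= C / c * (p / b ^+ 2) ^+ n.
  have h := char_fun_sub_one_le; near=> n.
  have bn : b ^+ n < m.+1%:R^-1 by near: n; exact: smallb.
  have up : 1 - complex.Re (phi n) <= C * p ^+ n by near: n; exact: h.
  have bn0 : 0 < b ^+ n by rewrite exprn_gt0.
  have low : c * (b ^+ n) ^+ 2 * a <= 1 - complex.Re (phi n).
    have i1 : mu.-integrable setT (EFin \o (fun=> 1 : R)).
      by apply: (@bounded_integrable _ _ _ mu (fun=> 1) 1) => // x; rewrite normr1.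
    have ic := integrable_cos mu (b ^+ n) (@measurable_id _ _ setT).
    have ii : mu.-integrable setT (EFin \o (\1_(annulus m) : R -> R)).
      apply: (@bounded_integrable _ _ _ mu (\1_(annulus m)) 1) => // x.
      by rewrite indicE; case: (_ \in _); rewrite ?normr0 ?normr1.
    have -> : 1 - complex.Re (phi n) = \int[mu]_x (1 - cos (b ^+ n * x)).
      by rewrite RintegralB// Rintegral_probability_cst.
    have -> : c * (b ^+ n) ^+ 2 * a = \int[mu]_x (c * (b ^+ n) ^+ 2 * \1_(annulus m) x).
      by rewrite RintegralZl// /Rintegral integral_indic// setIT.
    apply: le_Rintegral => //.
    - exact: (integrableZl measurableT (c * (b ^+ n) ^+ 2) ii).
    - exact: (integrableB measurableT i1 ic).
    - move=> x _; rewrite indicE; have [|_] := boolP (x \in _); last first.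
        by rewrite mulr0 subr_ge0 cos_le1.
      rewrite inE /annulus /= mulr1 => /andP[x1 x2].
      have bx : `|b ^+ n * x| <= 1.
        have := ler_pM (ltW bn0) (normr_ge0 x) (ltW bn) x2.
        by rewrite mulVf ?pnatr_eq0// normrM gtr0_norm.
      apply: le_trans (one_sub_cos_ge bx).
      rewrite /c -mulrA ler_wpM2l//.
        by rewrite divr_ge0// exprn_ge0// ltW// cos1_gt0.
      rewrite exprMn mulrC ler_wpM2l ?sqr_ge0//.
      by rewrite -(real_normK (num_real x)) lerXn2r ?nnegrE ?invr_ge0.
  have cb : 0 < c * (b ^+ n) ^+ 2 by rewrite mulr_gt0// exprn_gt0.
  have : a <= C * p ^+ n / (c * (b ^+ n) ^+ 2).
    by rewrite ler_pdivlMr// mulrC (le_trans low).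
  move/le_trans; apply; rewrite le_eqVlt; apply/orP; left; apply/eqP.
  rewrite expr_div_n -!exprM [(n * 2)%N]mulnC; field.
  by rewrite expf_neq0 ?gt_eqF.
have lim0 : C / c * (p / b ^+ 2) ^+ n @[n --> \oo] --> 0.
  rewrite -[X in _ --> X](mulr0 (C / c)); apply: cvgM; first exact: cvg_cst.
  apply: cvg_expr; rewrite ger0_norm; last by rewrite divr_ge0 ?exprn_ge0 ?ltW.
  by rewrite ltr_pdivrMr ?exprn_gt0// mul1r.
have a_le0 : a <= 0.
  rewrite -(cvg_lim _ lim0)//; apply: limr_ge => //.
  by apply/cvg_ex; exists 0.
rewrite -(fineK muf); congr EFin; apply/eqP.
by rewrite eq_le a0 a_le0.
Unshelve. all: end_near. Qed.

Lemma fast_decay_dirac0 : mu [set 0] = 1%E.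
Proof.
have U : \bigcup_m annulus m = ~` [set 0].
  apply/seteqP; split => [x [m _] /= /andP[x1 _] x0|x /= /eqP x0].
    by move: x1; rewrite x0 normr0 leNgt invr_gt0 ltr0n.
  have nx : 0 < `|x| by rewrite normr_gt0.
  exists (maxn (Num.truncn `|x|) (Num.truncn `|x|^-1)) => //=.
  apply/andP; split.
    rewrite invf_ple ?posrE//; apply: ltW; apply: lt_le_trans (truncnS_gt _) _.
    by rewrite ler_nat ltnS leq_maxr.
  apply: ltW; apply: lt_le_trans (truncnS_gt _) _.
  by rewrite ler_nat ltnS leq_maxl.
have neg : mu (~` [set 0]) = 0%E.
  rewrite -U; apply/negligibleP; first exact: bigcupT_measurable.
  by apply: negligible_bigcup => m; apply/negligibleP => //; exact: annulus0.
have := probability_setC mu (measurableC (measurable_set1 (0 : R))).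
by rewrite setCK neg sube0.
Qed.

End fast_decay.

Section sigma_gen_lemmas.
Context d (T : measurableType d) (R : realType) (P : probability T R).
Context (J : choiceType) (D : set J) (X : J -> {RV P >-> R}).

Lemma sigma_gen_preimage j A : D j -> measurable A -> sigma_gen D X (X j @^-1` A).
Proof.
move=> Dj mA; apply: sub_sigma_algebra; exists j => //.
by exists A => //; rewrite setTI.
Qed.

Lemma sigma_gen_sum (s : seq J) A : (forall j, j \in s -> D j) -> measurable A ->
  sigma_gen D X ((fun w => \sum_(j <- s) X j w) @^-1` A).
Proof.
move=> sD mA.
pose TG := g_sigma_algebraType
  (\bigcup_(j in D) preimage_set_system setT (X j) measurable).
have mX j : D j -> measurable_fun (setT : set TG) (X j : TG -> R).
  by move=> Dj _ B mB; rewrite setTI; exact: sigma_gen_preimage.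
have mS : measurable_fun (setT : set TG) (fun w : TG => \sum_(j <- s) X j w).
  elim: s sD => [|j r IH] rD.
    rewrite (_ : (fun w => _) = cst 0); first exact: measurable_cst.
    by apply/funext => w; rewrite big_nil.
  rewrite (_ : (fun w => _) = fun w => X j w + \sum_(j <- r) X j w); last first.
    by apply/funext => w; rewrite big_cons.
  apply: measurable_funD; first by apply: mX; apply: rD; rewrite inE eqxx.
  by apply: IH => j' jr; apply: rD; rewrite inE jr orbT.
by have := mS measurableT A mA; rewrite setTI.
Qed.

End sigma_gen_lemmas.

Section AR1_law.
Context d (T : measurableType d) (R : realType) (P : probability T R).
Context (k : nat) (b p : R) (Y eps : 'I_k -> nat -> {RV P >-> R})
  (I : nat -> {RV P >-> R}) (mu : probability R R).
Hypothesis AR : randomized_additive_AR1 b p Y eps I.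
Hypothesis stat : forall i, same_law (Y i 0%N) (eps i 1%N).
Hypothesis Ymu : forall i n, has_law (Y i n) mu.

(** The recursion is taken at n = 1, where [stat] gives the innovations the law mu and the past in
    [innovation_indep] is the initial vector. *)
Lemma char_fun_AR1 t : char_fun mu t ^+ k =
  char_fun mu (b * t) ^+ k * (p%:C + (1 - p)%:C * char_fun mu t ^+ k).
Proof.
have Yk n s : cf P (fun w => \sum_(i < k) Y i n w) s = char_fun mu s ^+ k.
  by apply: cf_sum_iid => //; have [] := Y_iid AR n.
have E1 s : cf P (fun w => \sum_(i < k) eps i 1%N w) s = char_fun mu s ^+ k.
  pose r : seq ('I_k * nat) := [seq (i, 1%N) | i <- index_enum 'I_k].
  have -> : (fun w => \sum_(i < k) eps i 1%N w) =
      (fun w => \sum_(q <- r) eps q.1 q.2 w).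
    by apply/funext => w; rewrite big_map.
  have [ind _] := eps_iid AR.
  rewrite (cf_sum ind); first last.
  - by move=> q /mapP[i _ ->].
  - by rewrite map_inj_uniq ?index_enum_uniq// => i j [].
  rewrite big_map (eq_bigr (fun=> char_fun mu s)) => [|i _].
    by rewrite prodr_const card_ord.
  by apply: cf_law => // A mA; rewrite -(Ymu i 0%N mA) (stat i mA).
have mYS n : measurable_fun setT (fun w => \sum_(i < k) Y i n w) by exact: measurable_sum.
have mES : measurable_fun setT (fun w => \sum_(i < k) eps i 1%N w) by exact: measurable_sum.
rewrite -{1}(Yk 1%N) -(Yk 0%N) -E1.
rewrite -(@cf_AR1 _ _ _ P (fun w => \sum_(i < k) Y i 0%N w) (I 1%N)
  (fun w => \sum_(i < k) eps i 1%N w))//.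
- apply: cf_ae_eq => //.
    by apply: measurable_funD; exact: measurable_funM.
  by apply: filterS (AR1_eq AR) => w /(_ 1%N isT).
- move=> A B C mA mB mC; apply: (innovation_indep AR (ltn0Sn 0)).
  + exact: sigma_gen_preimage.
  + exact: sigma_gen_sum.
  + pose r : seq ('I_k * nat) := [seq (i, 0%N) | i <- index_enum 'I_k].
    rewrite (_ : (fun w => \sum_(i < k) Y i 0%N w) =
        (fun w => \sum_(q <- r) Y q.1 q.2 w)); last first.
      by apply/funext => w; rewrite big_map.
    by apply: sigma_gen_sum => // q /mapP[i _ ->].
- by move=> w; exact: (I_range AR).
- exact: (I_eq1 AR).
Qed.

End AR1_law.

Lemma gen_semi_alpha_Laplace_of_AR1 (R : realType) (k : nat) (b p : R)
    (mu : probability R R) (hk : (0 < k)%N) (hb : 0 < b < 1) (hp : 0 < p < 1)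
    (h0 : mu [set 0] = 1%E -> b ^+ 2 <= p) :
  (forall t, char_fun mu t ^+ k =
    char_fun mu (b * t) ^+ k * (p%:C + (1 - p)%:C * char_fun mu t ^+ k)) ->
  gen_semi_alpha_Laplace p^-1 b k mu.
Proof.
move=> fE; have [b0 b1] := andP hb; have [p0 p1] := andP hp.
pose f t := char_fun mu t ^+ k.
have pC0 : p%:C != 0 :> R[i] by rewrite (fmorph_eq0 (real_complex R)) gt_eqF.
have f_step t : f t = 0 -> f (b * t) = 0.
  move=> ft; have := fE t; rewrite -/(f t) -/(f (b * t)) ft mulr0 addr0.
  by move=> /esym/eqP; rewrite mulf_eq0 (negbTE pC0) orbF => /eqP.
have f_neq0 t : f t != 0.
  apply/eqP => ft.
  have fn n : char_fun mu (b ^+ n * t) = 0.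
    have : f (b ^+ n * t) = 0.
      elim: n => [|n IH]; first by rewrite expr0 mul1r.
      by rewrite exprS -mulrA f_step.
    by move/eqP; rewrite expf_eq0 => /andP[_ /eqP].
  have c : (fun n => char_fun mu (b ^+ n * t)) @ \oo --> (1 : (R[i])^o).
    have cb : b ^+ n * t @[n --> \oo] --> 0.
      rewrite -[X in _ --> X](mul0r t); apply: cvgM; last exact: cvg_cst.
      by apply: cvg_expr; rewrite ger0_norm// ltW.
    rewrite -(char_fun0 mu).
    apply: (@cvg_comp _ _ _ (fun n => b ^+ n * t) (char_fun mu : R -> (R[i])^o)
      _ _ _ cb).
    exact: continuous_char_fun.
  rewrite (_ : (fun n => _) = cst 0) in c; last by apply/funext.
  have : (1 : (R[i])^o) = 0.
    exact: (cvg_unique (@norm_hausdorff _ (R[i])^o) c (cvg_cst _)).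
  by move/eqP; rewrite oner_eq0.
(* Then 1 + psi = 1 / f, so the characteristic function itself is the continuous root that
   [is_inv_root_branch] asks for. *)
pose psi t := (f t)^-1 - 1.
have psiE t : psi (b * t) = p%:C * psi t.
  have := fE t; rewrite -/(f t) -/(f (b * t)) => e.
  have := f_neq0 t; have := f_neq0 (b * t); rewrite /psi; move: e.
  move: (f t) (f (b * t)) => x y e y0 x0.
  (* Multiplied by x y, the claim becomes x - x y = p y - p x y, which is [e] rearranged. *)
  apply: (mulfI x0); apply: (mulfI y0).
  rewrite [LHS](_ : _ = x - y * x); last by field.
  rewrite [RHS](_ : _ = p%:C * y - p%:C * (y * x)); last by field.
  by rewrite {1}e rmorphB /= rmorph1; ring.
have psi1 t : 1 + psi t = (f t)^-1 by rewrite /psi addrC subrK.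
exists psi; split.
- split; first exact: continuous_char_fun.
    exact: char_fun0.
  by move=> t; rewrite psi1 invrK invr_eq0; split.
- move=> t; rewrite psiE mulrA -rmorphM /= mulVf ?gt_eqF// rmorph1.
  by rewrite mul1r.
- exists (ln p / ln b).
  have lnb : ln b < 0 by exact: ln_lt0.
  have lnp : ln p < 0 by exact: ln_lt0.
  split; last first.
    rewrite /powR gt_eqF// divfK ?lt_eqF// lnK ?posrE//.
    by rewrite mulVf// gt_eqF.
  apply/andP; split; first by rewrite -mulrNN -invrN divr_gt0// oppr_gt0.
  (* As ln b < 0, the bound alpha <= 2 amounts to 2 ln b <= ln p. *)
  have bp : b ^+ 2 <= p.
    rewrite leNgt; apply/negP => pb.
    have : mu [set 0] = 1%E.
      apply: (@fast_decay_dirac0 R mu k b p (psi 1)) => // n.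
      have : psi (b ^+ n) = (p ^+ n)%:C * psi 1.
        elim: n => [|n IH]; first by rewrite !expr0 rmorph1 mul1r.
        by rewrite exprS psiE IH exprS rmorphM /= mulrA.
      move=> <-; rewrite -/(f (b ^+ n)) /psi mulrBl mulVf ?f_neq0//.
      by rewrite mul1r.
    by move/h0; rewrite leNgt pb.
  rewrite ler_ndivrMr// mulrC mulr_natr -lnXn// ler_ln ?posrE//.
  exact: exprn_gt0.
Qed.

Local Close Scope complex_scope.

(** * Uniform random variables from binary digits *)

Section noise.
Context (R : realType).
Implicit Types (x y : R) (A B : set R).

Let idR : measurableTypeR R -> R := idfun.

Let measurable_idR : measurable_fun setT idR.
Proof. by move=> _ A mA; rewrite setTI. Qed.

HB.instance Definition _ :=
  isMeasurableFun.Build _ _ _ _ idR measurable_idR.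

(* [uniform_prob] lives on [measurableTypeR R], whose display differs from the
   one of [R]. *)
Definition unif01 : probability R R := distribution (uniform_prob (@ltr01 R)) idR.

(** The distribution function of [unif01]. *)
Definition clip x : R := Num.max 0 (Num.min x 1).

Lemma unif01_lebesgue A : measurable A ->
  unif01 A = lebesgue_measure (A `&` `[0, 1]%classic).
Proof.
move=> mA; rewrite /unif01 /= /distribution /pushforward /uniform_prob integral_uniform_pdf.
rewrite (eq_integral (cst 1%E)); last first.
  move=> x; rewrite inE => -[_]; rewrite /= in_itv /uniform_pdf => /= ->.
  by rewrite subr0 invr1.
by rewrite integral_cst ?mul1e//; exact: measurableI.
Qed.

Lemma clip_le0 x : x <= 0 -> clip x = 0.
Proof. by move=> x0; rewrite /clip min_l ?max_l// (le_trans x0). Qed.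

Lemma clip_id x : 0 <= x <= 1 -> clip x = x.
Proof. by move=> /andP[x0 x1]; rewrite /clip min_l// max_r. Qed.

Lemma clip_ge1 x : 1 <= x -> clip x = 1.
Proof. by move=> x1; rewrite /clip min_r// max_r. Qed.

Lemma unif01_lray x : unif01 `]-oo, x[%classic = (clip x)%:E.
Proof.
rewrite unif01_lebesgue//.
have [x0|x0] := leP x 0.
  rewrite (_ : _ `&` _ = set0) ?measure0 ?clip_le0//.
  apply/seteqP; split => // z [] /=; rewrite !in_itv/= => zx /andP[z0 _].
  by move: (le_lt_trans z0 zx); rewrite ltNge x0.
have [x1|x1] := leP x 1.
  rewrite (_ : _ `&` _ = `[0, x[%classic).
    by rewrite lebesgue_measure_itv/= lte_fin x0 sube0 clip_id// ltW.
  apply/seteqP; split => z /=; rewrite !in_itv/=; first by case=> -> /andP[->].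
  by move=> /andP[-> zx]; split => //; rewrite (le_trans (ltW zx)).
rewrite (_ : _ `&` _ = `[0, 1]%classic).
  by rewrite lebesgue_measure_itv/= lte_fin ltr01 sube0 clip_ge1// ltW.
apply/seteqP; split => z /=; rewrite !in_itv/=; first by case.
by move=> /andP[-> z1]; split => //; exact: le_lt_trans x1.
Qed.

(** On [0, 1] this is the shift of binary expansions: it drops the leading digit, read off by the
    comparison with 1/2. *)
Definition doubling x := if x < 2^-1 then 2 * x else 2 * x - 1.

Lemma measurable_lt_half : measurable [set x : R | x < 2^-1].
Proof.
by rewrite (_ : [set _ | _] = `]-oo, 2^-1[%classic)//; apply/seteqP; split.
Qed.

Lemma measurable_doubling : measurable_fun setT doubling.
Proof.
apply: measurable_fun_ifT => //=.
- exact: measurable_fun_ltr.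
- exact: measurable_funB.
Qed.

Let half_measure E (mE : measurable E) : {measure set R -> \bar R} :=
  measure_function_pushforward__canonical__measure_function_Measure
  (mrestr unif01 mE) measurable_doubling.

Lemma unif01_doubling E (mE : measurable E) :
  (forall x, unif01 (doubling @^-1` `]-oo, x[ `&` E) = (2^-1 * clip x)%:E) ->
  forall A, measurable A ->
    unif01 (doubling @^-1` A `&` E) = ((2^-1)%:E * unif01 A)%E.
Proof.
move=> h A mA.
have h0 : 0 <= (2^-1 : R) by lra.
apply: (@measure_eq_lray _ (half_measure mE) (mscale (NngNum h0) unif01)) => //.
- change (unif01 (doubling @^-1` setT `&` E) < +oo)%E.
  by rewrite ltey_eq fin_num_measure// preimage_setT setTI.
- move=> x; change (unif01 (doubling @^-1` `]-oo, x[ `&` E) =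
    (2^-1)%:E * unif01 `]-oo, x[%classic)%E.
  by rewrite h unif01_lray EFinM.
Qed.

(** The leading digit is fair and, whatever its value, the digits after it are uniform;
    [unif01_doubling1] is the other case. *)
Lemma unif01_doubling0 A : measurable A ->
  unif01 (doubling @^-1` A `&` [set x | x < 2^-1]) = ((2^-1)%:E * unif01 A)%E.
Proof.
apply: unif01_doubling => [|x]; first exact: measurable_lt_half.
rewrite (_ : _ `&` _ = `]-oo, (Num.min 1 x / 2)[%classic).
  rewrite unif01_lray; congr EFin.
  have [x1|x1] := leP x 1; last first.
    by rewrite clip_id ?(@clip_ge1 x) ?mulr1; lra.
  by have [x0|x0] := leP x 0; [rewrite !clip_le0|rewrite !clip_id]; lra.
apply/seteqP; split => z; rewrite /doubling /= !in_itv/=.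
  by case=> + zh; rewrite zh => zx; rewrite ltr_pdivlMr// lt_min; apply/andP; split; lra.
rewrite ltr_pdivlMr// lt_min => /andP[z1 zx].
have zh : z < 2^-1 by lra.
by rewrite zh; split => //; lra.
Qed.

Lemma unif01_doubling1 A : measurable A ->
  unif01 (doubling @^-1` A `&` ~` [set x | x < 2^-1]) = ((2^-1)%:E * unif01 A)%E.
Proof.
have mh := measurable_lt_half.
apply: unif01_doubling => [|x]; first exact: measurableC.
have [x0|x0] := leP x 0.
  rewrite (_ : _ `&` _ = set0).
    by rewrite measure0 clip_le0 ?mulr0.
  apply/seteqP; split => // z [] /=; rewrite /doubling in_itv/=.
  by case: (ltP z 2^-1) => zh zx; [by move=> /(_ isT)|lra].
set S := _ `&` _.
(* Joined with the points below 1/2, [S] becomes a ray, so its measure is a difference of two values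
   of [clip]. *)
have SE : `]-oo, ((1 + x) / 2)[%classic = `]-oo, 2^-1[%classic `|` S.
  apply/seteqP; split => z; rewrite /S /= /doubling !in_itv/=.
    rewrite ltr_pdivlMr// => zx; case: (ltP z 2^-1) => zh; [by left|right].
    by split; [lra|].
  case=> [zh|[]]; first by rewrite ltr_pdivlMr//; lra.
  by case: (ltP z 2^-1) => zh zx; [by move=> /(_ isT)|rewrite ltr_pdivlMr//; lra].
have mS : measurable S.
  apply: measurableI; last exact: measurableC.
  exact: measurable_preimage measurable_doubling _.
have e : (unif01 (`]-oo, (2^-1)%R[ `|` S)%classic =
    unif01 `]-oo, (2^-1)%R[%classic + unif01 S)%E.
  apply: measureU => //; apply/seteqP; split => // z [] /=.
  by rewrite in_itv/= => zh [_]; move/negP; rewrite zh.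
have Sf : unif01 S \is a fin_num by rewrite fin_num_measure.
move: e; rewrite -SE !unif01_lray -(fineK Sf) -EFinD => -[] e; congr EFin; move: e.
rewrite (@clip_id 2^-1); last by lra.
have [x1|x1] := leP x 1; first by rewrite !clip_id; lra.
by rewrite !clip_ge1; lra.
Qed.

Lemma unif01_split E : measurable E ->
  unif01 E = (unif01 (E `&` [set x | (x < 2^-1)%R]) +
    unif01 (E `&` ~` [set x | (x < 2^-1)%R]))%E.
Proof.
move=> mE; have mh := measurable_lt_half.
rewrite -measureU; first by rewrite -setIUr setUv setIT.
- exact: measurableI.
- by apply: measurableI => //; exact: measurableC.
- by rewrite setIACA setICr setI0.
Qed.

Lemma unif01_doublingT A : measurable A -> unif01 (doubling @^-1` A) = unif01 A.
Proof.
move=> mA; rewrite unif01_split; last exact: measurable_preimage measurable_doubling _.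
rewrite unif01_doubling0// unif01_doubling1//.
rewrite -(@fineK _ (unif01 A)) ?fin_num_measure// -!EFinM -EFinD.
by congr EFin; lra.
Qed.

(** The leading digit is treated first, so raising n appends a digit at the tail; hence the sequence
    increases. *)
Fixpoint even_digits n x : R :=
  if n is n'.+1 then ((2^-1 <= x)%R%:R + even_digits n' (doubling (doubling x))) / 2
  else 0.

Lemma even_digits_itv n x : 0 <= even_digits n x <= 1.
Proof.
elim: n x => [|n IH] x /=; first by rewrite lexx ler01.
by have := IH (doubling (doubling x)); case: (_ <= x); rewrite ?mulr0n ?mulr1n; lra.
Qed.

Lemma even_digits_nondecreasing x : nondecreasing_seq (even_digits ^~ x).
Proof.
apply/nondecreasing_seqP => n; elim: n x => [|n IH] x.
  by have /andP[] := even_digits_itv 1 x.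
have E m : even_digits m.+1 x =
    ((2^-1 <= x)%R%:R + even_digits m (doubling (doubling x))) / 2 by [].
by have := IH (doubling (doubling x)); rewrite 2!E; lra.
Qed.

(* The numbers whose binary digits are the even-indexed, resp. odd-indexed,
   binary digits of [x]. *)
Definition lsplit x : R := limn (even_digits ^~ x).
Definition rsplit x := lsplit (doubling x).

Lemma cvg_even_digits x : even_digits ^~ x @ \oo --> lsplit x.
Proof.
apply: nondecreasing_is_cvgn; first exact: even_digits_nondecreasing.
by exists 1 => _ [n _ <-]; case/andP: (even_digits_itv n x).
Qed.

Lemma lsplit_itv x : 0 <= lsplit x <= 1.
Proof.
have cx : cvgn (even_digits ^~ x) by apply/cvg_ex; exists (lsplit x); exact: cvg_even_digits.
apply/andP; split.
- by apply: limr_ge => //; apply: nearW => n; case/andP: (even_digits_itv n x).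
- by apply: limr_le => //; apply: nearW => n; case/andP: (even_digits_itv n x).
Qed.

(** Dropping one digit exchanges even and odd positions. This is the source of the exchange of x and
    y in [FE]. *)
Lemma lsplitE x : lsplit x = ((2^-1 <= x)%R%:R + rsplit (doubling x)) / 2.
Proof.
apply: (@cvg_unique _ _ (even_digits n.+1 x @[n --> \oo])) => //.
  by have := @cvg_even_digits x; rewrite -cvg_shiftS.
apply: cvgM; last exact: cvg_cst.
by apply: cvgD; [exact: cvg_cst|exact: cvg_even_digits].
Qed.

Lemma measurable_lsplit : measurable_fun setT lsplit.
Proof.
apply: (@measurable_fun_cvg _ _ _ _ (fun n x => even_digits n x)) => [n|x _].
  elim: n => [|n IH] /=; first exact: measurable_cst.
  apply: measurable_funM => //; apply: measurable_funD.
    rewrite (_ : (fun x => _) = \1_`[2^-1, +oo[%classic).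
      exact: measurable_indic.
    apply/funext => x; rewrite indicE; case: leP => h.
      by rewrite mem_set//= in_itv/= h.
    by rewrite memNset//= in_itv/= andbT leNgt h.
  apply: measurableT_comp => //.
  by apply: measurableT_comp; exact: measurable_doubling.
exact: cvg_even_digits.
Qed.

Lemma measurable_rsplit : measurable_fun setT rsplit.
Proof. by apply: measurableT_comp; [exact: measurable_lsplit|exact: measurable_doubling]. Qed.

Let F x y := fine (unif01 (lsplit @^-1` `]-oo, x[ `&` rsplit @^-1` `]-oo, y[)).
Let F1 x := fine (unif01 (lsplit @^-1` `]-oo, x[)).

Let mray x : measurable (lsplit @^-1` `]-oo, x[).
Proof. exact: measurable_preimage measurable_lsplit _. Qed.

Let mray2 x y : measurable (lsplit @^-1` `]-oo, x[ `&` rsplit @^-1` `]-oo, y[).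
Proof.
by apply: measurableI => //; exact: measurable_preimage measurable_rsplit _.
Qed.

Let fineD2 (a b : \bar R) : a \is a fin_num -> b \is a fin_num ->
  fine ((2^-1)%:E * a + (2^-1)%:E * b)%E = 2^-1 * fine a + 2^-1 * fine b.
Proof. by move=> af bf; rewrite fineD ?fin_numM// !fineM. Qed.

Let lsplit_lo z x : z < 2^-1 -> (lsplit z < x) = (rsplit (doubling z) < 2 * x).
Proof.
by move=> zh; rewrite lsplitE leNgt zh mulr0n add0r ltr_pdivrMr// mulrC.
Qed.

Let lsplit_hi z x : ~ z < 2^-1 -> (lsplit z < x) = (rsplit (doubling z) < 2 * x - 1).
Proof.
move=> /negP zh; rewrite lsplitE leNgt zh mulr1n ltr_pdivrMr// mulrC.
by rewrite ltrBrDl.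
Qed.

Let F1E x : F1 x = 2^-1 * F1 (2 * x) + 2^-1 * F1 (2 * x - 1).
Proof.
rewrite /F1 unif01_split//.
have -> : lsplit @^-1` `]-oo, x[ `&` [set x | x < 2^-1] =
    doubling @^-1` (rsplit @^-1` `]-oo, 2 * x[) `&` [set x | x < 2^-1].
  by apply/seteqP; split => z [] /=; rewrite !in_itv/= => + zh; rewrite (lsplit_lo _ zh) => a; split.
have -> : lsplit @^-1` `]-oo, x[ `&` ~` [set x | x < 2^-1] =
    doubling @^-1` (rsplit @^-1` `]-oo, 2 * x - 1[) `&` ~` [set x | x < 2^-1].
  by apply/seteqP; split => z [] /=; rewrite !in_itv/= => + zh; rewrite (lsplit_hi _ zh) => a; split.
have mr y : measurable (rsplit @^-1` `]-oo, y[).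
  exact: measurable_preimage measurable_rsplit _.
rewrite unif01_doubling0// unif01_doubling1// fineD2 ?fin_num_measure//.
by rewrite (unif01_doublingT (mray _)) (unif01_doublingT (mray _)).
Qed.

(* [F x y] and [clip x * clip y] solve the same functional equation: at each step
   one of the two terms is explicit, so their distance is halved. *)
Let FE x y : F x y = 2^-1 * F y (2 * x) + 2^-1 * F y (2 * x - 1).
Proof.
rewrite /F unif01_split//.
have -> : lsplit @^-1` `]-oo, x[ `&` rsplit @^-1` `]-oo, y[ `&` [set x | x < 2^-1] =
    doubling @^-1` (lsplit @^-1` `]-oo, y[ `&` rsplit @^-1` `]-oo, 2 * x[) `&`
      [set x | x < 2^-1].
  by apply/seteqP; split => z /= [[]]; rewrite !in_itv/= => + + zh;
    rewrite (lsplit_lo _ zh) => a b; do 2 split => //.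
have -> : lsplit @^-1` `]-oo, x[ `&` rsplit @^-1` `]-oo, y[ `&` ~` [set x | x < 2^-1] =
    doubling @^-1` (lsplit @^-1` `]-oo, y[ `&` rsplit @^-1` `]-oo, 2 * x - 1[) `&`
      ~` [set x | x < 2^-1].
  by apply/seteqP; split => z /= [[]]; rewrite !in_itv/= => + + zh;
    rewrite (lsplit_hi _ zh) => a b; do 2 split => //.
by rewrite unif01_doubling0// unif01_doubling1// fineD2// fin_num_measure.
Qed.

Let F1_le0 x : x <= 0 -> F1 x = 0.
Proof.
move=> x0; rewrite /F1 (_ : _ @^-1` _ = set0) ?measure0//.
apply/seteqP; split => // z /=; rewrite in_itv/= => zx.
by have := lsplit_itv z; lra.
Qed.

Let F1_gt1 x : 1 < x -> F1 x = 1.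
Proof.
move=> x0; rewrite /F1 (_ : _ @^-1` _ = setT) ?probability_setT//.
apply/seteqP; split => // z _ /=; rewrite in_itv/=.
by have := lsplit_itv z; lra.
Qed.

Let F1_itv x : 0 <= F1 x <= 1.
Proof.
apply/andP; split; first exact: fine_ge0.
rewrite -lee_fin fineK ?fin_num_measure//.
exact: probability_le1 (mray x).
Qed.

Let clip_itv x : 0 <= clip x <= 1.
Proof.
have [x0|x0] := leP x 0; first by rewrite clip_le0// lexx ler01.
have [x1|x1] := leP x 1; last by rewrite clip_ge1 ?lexx ?ler01// ltW.
by rewrite clip_id ?x1 ltW.
Qed.

Let pow_small (z : R) : (forall n, `|z| <= (2^-1) ^+ n) -> z = 0.
Proof.
move=> h; apply/eqP; rewrite -normr_le0.
have c : (2^-1 : R) ^+ n @[n --> \oo] --> 0 by apply: cvg_expr; rewrite ger0_norm; lra.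
by rewrite -(cvg_lim _ c)//; apply: limr_ge; [apply/cvg_ex; exists 0|exact: nearW].
Qed.

(** Each use of [F1E] halves the distance: 2 x - 1 <= 0 when x <= 1/2 and 2 x > 1 otherwise, so one
    of its two terms is exact. The marginal is needed first because, through [F_gt1], it is the
    explicit term of the two-dimensional recursion. *)
Let F1_clip x : F1 x = clip x.
Proof.
apply/eqP; rewrite -subr_eq0; apply/eqP; apply: pow_small => n.
elim: n x => [|n IH] x.
  have := F1_itv x; have := clip_itv x; rewrite expr0 ler_norml; lra.
rewrite F1E exprS; have [xh|xh] := leP x 2^-1.
  have := IH (2 * x); rewrite (@F1_le0 (2 * x - 1)); last by lra.
  have [x0|x0] := leP x 0.
    by rewrite !clip_le0; [|lra..]; rewrite !ler_norml; lra.
  rewrite !clip_id; [|lra..]; rewrite !ler_norml; lra.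
rewrite (@F1_gt1 (2 * x)); last by lra.
have := IH (2 * x - 1); have [x1|x1] := leP x 1.
  rewrite !clip_id; [|lra..]; rewrite !ler_norml; lra.
rewrite !clip_ge1; [|lra..]; rewrite !ler_norml; lra.
Qed.

Let F_le0 x y : y <= 0 -> F x y = 0.
Proof.
move=> y0; rewrite /F (_ : _ `&` _ = set0) ?measure0//.
apply/seteqP; split => // z [_] /=; rewrite in_itv/= => zy.
by have := lsplit_itv (doubling z); rewrite -/(rsplit z); lra.
Qed.

Let F_gt1 x y : 1 < y -> F x y = clip x.
Proof.
move=> y1; rewrite /F (_ : _ `&` _ = lsplit @^-1` `]-oo, x[); first exact: F1_clip.
apply/seteqP; split => [z []//|z zx]; split => //=; rewrite in_itv/=.
by have := lsplit_itv (doubling z); rewrite -/(rsplit z); lra.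
Qed.

Let F_itv x y : 0 <= F x y <= 1.
Proof.
apply/andP; split; first exact: fine_ge0.
rewrite -lee_fin fineK ?fin_num_measure//.
exact: probability_le1 (mray2 x y).
Qed.

Let F_clip x y : F x y = clip x * clip y.
Proof.
apply/eqP; rewrite -subr_eq0; apply/eqP; apply: pow_small => n.
elim: n x y => [|n IH] x y.
  have /andP[a0 a1] := F_itv x y; have /andP[b0 b1] := clip_itv x.
  have /andP[c0 c1] := clip_itv y.
  have : clip x * clip y <= 1 by rewrite mulr_ile1.
  have : 0 <= clip x * clip y by rewrite mulr_ge0.
  rewrite expr0 ler_norml; lra.
rewrite FE exprS; have [xh|xh] := leP x 2^-1.
  have := IH y (2 * x); rewrite (@F_le0 _ (2 * x - 1)); last by lra.
  have [x0|x0] := leP x 0.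
    by rewrite (@clip_le0 x) ?(@clip_le0 (2 * x)); [|lra..]; rewrite !ler_norml; lra.
  rewrite (@clip_id x) ?(@clip_id (2 * x)); [|lra..].
  rewrite !ler_norml; lra.
rewrite (@F_gt1 _ (2 * x)); last by lra.
have := IH y (2 * x - 1); have [x1|x1] := leP x 1.
  rewrite (@clip_id x) ?(@clip_id (2 * x - 1)); [|lra..]; rewrite !ler_norml; lra.
rewrite (@clip_ge1 x) ?(@clip_ge1 (2 * x - 1)); [|lra..]; rewrite !ler_norml; lra.
Qed.

Lemma unif01_lsplit A : measurable A -> unif01 (lsplit @^-1` A) = unif01 A.
Proof.
apply: (@measure_eq_lray _ (measure_function_pushforward__canonical__measure_function_Measure
  unif01 measurable_lsplit) unif01).
- change (unif01 (lsplit @^-1` setT) < +oo)%E.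
  by rewrite ltey_eq fin_num_measure// preimage_setT.
- move=> x; change (unif01 (lsplit @^-1` `]-oo, x[) = unif01 `]-oo, x[%classic).
  by rewrite unif01_lray -F1_clip /F1 fineK// fin_num_measure.
Qed.

Lemma unif01_rsplit A : measurable A -> unif01 (rsplit @^-1` A) = unif01 A.
Proof.
move=> mA; rewrite -(unif01_lsplit mA) -(unif01_doublingT (A := lsplit @^-1` A))//.
exact: measurable_preimage measurable_lsplit _.
Qed.

Lemma indep2_split : indep2 unif01 lsplit rsplit.
Proof.
apply: indep2_lray; [exact: measurable_lsplit|exact: measurable_rsplit|].
move=> x y; rewrite unif01_lsplit// unif01_rsplit// !unif01_lray -EFinM -F_clip.
by rewrite /F fineK// fin_num_measure.
Qed.

End noise.

Arguments unif01 {R}.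
Arguments lsplit {R}.
Arguments rsplit {R}.

(** * Conditional quantile functions *)

Section conditional_density.
Context d (T : measurableType d) (R : realType) (P : probability T R).
Variables (X : {mfun T >-> R}) (E : set T).
Hypothesis mE : measurable E.

Let mX : measurable_fun setT X. Proof. by []. Qed.

Let nu (A : set R) := P (X @^-1` A `&` E).

HB.instance Definition _ := Measure.copy nu
  (measure_function_pushforward__canonical__measure_function_Measure
    (mrestr P mE) mX).

Let nu_fin : fin_num_fun nu.
Proof.
move=> A mA; apply: fin_num_measure; apply: measurableI => //.
exact: measurable_preimage mX _.
Qed.

HB.instance Definition _ := Measure_isFinite.Build _ _ _ nu nu_fin.

(** A version of P(E | X = s): the Radon-Nikodym derivative of A |-> P(X in A, E), which is
    dominated by the law of X. *)
Lemma conditional_density : exists h : R -> R,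
  [/\ measurable_fun setT h, (forall s, 0 <= h s) &
    forall A, measurable A ->
      P (X @^-1` A `&` E) = (\int[distribution P X]_(s in A) (h s)%:E)%E].
Proof.
have [|f [f0 ff fi fE]] := @radon_nikodym_sigma_finite _ _ R (distribution P X) nu.
  apply/null_content_dominatesP => A mA A0; apply/eqP; rewrite eq_le measure_ge0 andbT.
  rewrite -A0 /nu /distribution /pushforward; apply: le_measure; rewrite ?inE//.
  - apply: measurableI => //; exact: measurable_preimage mX _.
  - exact: measurable_preimage mX _.
exists (fine \o f); split.
- by apply: measurableT_comp => //; exact: measurable_int fi.
- by move=> s; rewrite fine_ge0.
- move=> A mA; rewrite -[LHS]/(nu A) fE//.
  by apply: eq_integral => s _; rewrite /= fineK.
Qed.

End conditional_density.

(** The hypothesis is applied to the set {g < f} itself, where f - g is positive but has integral at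
    most 0. *)
Lemma null_set_of_le_integral d' (T' : measurableType d') (R : realType)
    (Q : {measure set T' -> \bar R})
    (f g : T' -> R) :
  Q.-integrable setT (EFin \o f) -> Q.-integrable setT (EFin \o g) ->
  (forall A, measurable A ->
    (\int[Q]_(x in A) (f x)%:E <= \int[Q]_(x in A) (g x)%:E)%E) ->
  Q [set x | g x < f x] = 0%E.
Proof.
move=> fi gi fg.
have mf : measurable_fun setT f by apply/measurable_EFinP; exact: measurable_int fi.
have mg : measurable_fun setT g by apply/measurable_EFinP; exact: measurable_int gi.
set A := [set x | _].
have mA : measurable A.
  rewrite -[A]setTI; have := measurable_fun_ltr mg mf measurableT (Y := [set true]).
  by apply.
have fAi := integrableS measurableT mA (@subsetT _ _) fi.
have gAi := integrableS measurableT mA (@subsetT _ _) gi.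
have := fg A mA; rewrite -sube_le0 => le0.
pose D x := ((f x)%:E - (g x)%:E)%E.
have h0 x : A x -> (0 <= D x)%E.
  by rewrite /D => /= Ax; rewrite lee_fin subr_ge0 ltW.
have : (\int[Q]_(x in A) `|D x| = 0)%E.
  under eq_integral => x xA.
    rewrite gee0_abs; last by apply: h0; rewrite inE in xA.
    over.
  apply/eqP; rewrite eq_le; apply/andP; split; last by apply: integral_ge0.
  by rewrite integralB.
have mh : measurable_fun A D.
  apply: emeasurable_funB; first exact: measurable_int fAi.
  exact: measurable_int gAi.
move/(ae_eq_integral_abs Q mA mh).1 => H.
apply/negligibleP => //; apply: negligibleS H => x /= Ax /(_ Ax).
by rewrite /D -EFinB => -[] /eqP; rewrite subr_eq0 => /eqP fgx; move: Ax; rewrite /A /= fgx ltxx.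
Qed.

Section transfer.
Context d (T : measurableType d) (R : realType) (P : probability T R).
Variables (X Z : {mfun T >-> R}).

Let mX : measurable_fun setT X. Proof. by []. Qed.
Let mZ : measurable_fun setT Z. Proof. by []. Qed.
Let m : probability R R := distribution P X.

Let mZle (x : R) : measurable (Z @^-1` `]-oo, x]).
Proof. exact: measurable_preimage mZ _. Qed.

(* The densities of the measures P (X \in A /\ Z <= q) are almost surely
   monotone in q; they vanish identically on the exceptional set. *)
Lemma monotone_conditional_cdf : exists h : rat -> R -> R,
  [/\ forall q, measurable_fun setT (h q), forall q s, 0 <= h q s <= 1,
     forall q q' s, q <= q' -> h q s <= h q' s &
     forall q A, measurable A -> P (X @^-1` A `&` Z @^-1` `]-oo, ratr q]) =
       (\int[m]_(s in A) (h q s)%:E)%E].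
Proof.
have [h hP] := choice (fun q : rat => conditional_density P X (mZle (ratr q))).
have mh q : measurable_fun setT (h q) by have [] := hP q.
have h0 q s : 0 <= h q s by have [] := hP q.
have hE q A : measurable A -> P (X @^-1` A `&` Z @^-1` `]-oo, ratr q]) =
    (\int[m]_(s in A) (h q s)%:E)%E by have [_ _] := hP q; exact.
have mXA A : measurable A -> measurable (X @^-1` A).
  exact: measurable_preimage mX.
have hi q : m.-integrable setT (EFin \o h q).
  apply/integrableP; split; first exact/measurable_EFinP.
  under eq_integral do rewrite gee0_abs ?lee_fin//.
  by rewrite -hE// ltey_eq fin_num_measure//; apply: measurableI => //; exact: mXA.
have i1 : m.-integrable setT (EFin \o cst (1 : R)).
  by apply: (@bounded_integrable _ _ _ _ _ 1) => // x; rewrite normr1.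
have null1 q : m [set s | 1 < h q s] = 0%E.
  apply: (null_set_of_le_integral (hi q) i1) => A mA.
  have -> : (\int[m]_(s in A) (cst (1 : R) s)%:E = m A)%E.
    transitivity (\int[m]_(s in A) cst 1%E s)%E => //.
    by rewrite integral_cst// mul1e.
  rewrite -hE//; apply: le_measure; rewrite ?inE//.
  - by apply: measurableI => //; exact: mXA.
  - exact: mXA.
have null2 q q' : q <= q' -> m [set s | h q' s < h q s] = 0%E.
  move=> qq'; apply: (null_set_of_le_integral (hi q) (hi q')) => A mA.
  rewrite -!hE//; apply: le_measure; rewrite ?inE.
  - by apply: measurableI => //; exact: mXA.
  - by apply: measurableI => //; exact: mXA.
  - apply: setIS => t /=; rewrite !in_itv/= => /le_trans; apply.
    by rewrite ler_rat.
have mlt (f g : R -> R) : measurable_fun setT f -> measurable_fun setT g ->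
    measurable [set s | f s < g s].
  move=> mf mg; have := measurable_fun_ltr mf mg measurableT (Y := [set true]).
  by rewrite setTI; apply.
(* Pairs of rationals are enumerated by [pickle], which makes the exceptional set a union over
   nat. *)
pose N1 (n : nat) : set R :=
  if @choice.unpickle (rat * rat)%type n is Some (q, q') then
  (if (q <= q') then [set s | h q' s < h q s] else set0) `|`
    [set s | 1 < h q s] else set0.
have N1E (q q' : rat) : N1 (choice.pickle (q, q')) =
    (if (q <= q') then [set s | h q' s < h q s] else set0) `|` [set s | 1 < h q s].
  by rewrite /N1 choice.pickleK.
have mN1 n : measurable (N1 n).
  rewrite /N1; case: (choice.unpickle n) => [[q q']|//].
  apply: measurableU; last exact: mlt.
  by case: ifP => // _; exact: mlt.
have N10 n : m.-negligible (N1 n).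
  apply/negligibleP => //; rewrite /N1; case: (choice.unpickle n) => [[q q']|].
    case: ifP => [qq'|_]; last by rewrite set0U; exact: null1.
    by apply: null_set_setU; [exact: mlt|exact: mlt|exact: null2|exact: null1].
  by rewrite measure0.
pose N := \bigcup_n N1 n.
have mN : measurable N by exact: bigcupT_measurable.
have N0 : m.-negligible N by exact: negligible_bigcup.
have inN q q' s : ~ N s -> (q <= q' -> h q s <= h q' s) /\ h q s <= 1.
  move=> Ns; split.
    move=> qq'; rewrite leNgt; apply/negP => lt; apply: Ns.
    by exists (choice.pickle (q, q')); [exact: I|rewrite N1E qq'; left; exact: lt].
  rewrite leNgt; apply/negP => lt; apply: Ns.
  by exists (choice.pickle (q, q')); [exact: I|rewrite N1E; right; exact: lt].
pose h' q s := if s \in N then 0 else h q s.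
have mh' q : measurable_fun setT (h' q).
  apply: measurable_fun_ifT => //.
  apply: (measurable_fun_bool true); rewrite setTI.
  by rewrite (_ : _ @^-1` _ = N)//; apply/seteqP; split => s /=; [move/set_mem|move/mem_set].
exists h'; split => //.
- move=> q s; rewrite /h'; case: ifPn => [_|]; first by rewrite lexx ler01.
  by rewrite notin_setE => /(inN q q)[_ ->]; rewrite h0.
- move=> q q' s qq'; rewrite /h'; case: ifPn => // ; rewrite notin_setE.
  by move=> /(inN q q')[/(_ qq')].
- move=> q A mA; rewrite hE//; apply: ae_eq_integral => //.
  + by apply/measurable_EFinP; exact: measurable_funTS.
  + by apply/measurable_EFinP; exact: measurable_funTS.
  + apply: negligibleS N0 => s /= /not_implyP[_]; rewrite /h'.
    by case: ifPn => //; rewrite inE.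
Qed.

Let M : probability (R * R)%type R := (m \x unif01)%E.

(** The section over s is the ray below [h s], whose uniform measure is [h s] because [h s] lies in
    [0, 1]. *)
Let M_under (h : R -> R) A : measurable_fun setT h -> (forall s, 0 <= h s <= 1) ->
  measurable A -> M [set z | A z.1 /\ z.2 < h z.1] = (\int[m]_(s in A) (h s)%:E)%E.
Proof.
move=> mh h01 mA; rewrite integral_mkcond.
pose W := [set z : R * R | A z.1 /\ z.2 < h z.1]; rewrite -/W.
change (\int[m]_s unif01 (xsection W s) = \int[m]_s ((fun s => (h s)%:E) \_ A) s)%E.
apply: eq_integral => s _; rewrite patchE; case: ifPn => As.
  rewrite (_ : xsection _ _ = `]-oo, h s[%classic).
    by rewrite unif01_lray clip_id.
  apply/seteqP; split => u /=; rewrite /xsection/W/= inE/= in_itv/=; first by case.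
  by rewrite inE in As.
rewrite (_ : xsection _ _ = set0) ?measure0//.
apply/seteqP; split => u //=; rewrite /xsection/W/= inE/= => -[].
by rewrite notin_setE in As.
Qed.

(** Turns a union over the rationals below x into a monotone union, to which continuity from below
    applies. *)
Let rat_seq (x : R) : exists r : nat -> rat, [/\ {homo r : n n' / (n <= n')%N >-> n <= n'},
  forall n, ratr (r n) < x & forall q : rat, ratr q < x -> exists n, q <= r n].
Proof.
have /choice[q qP] : forall n, exists q : rat, ratr q \in `]x - n.+1%:R^-1, x[.
  by move=> n; apply: rat_in_itvoo; rewrite ltrBlDr ltrDl invr_gt0.
pose r := fix r n := if n is n'.+1 then Num.max (r n') (q n) else q 0%N.
have rx n : ratr (r n) < x.
  elim: n => [|n IH] /=; first by have := qP 0%N; rewrite in_itv => /andP[].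
  rewrite /Num.max; case: ifP => // _.
  by have := qP n.+1; rewrite in_itv => /andP[].
have qr n : q n <= r n by case: n => [|n] //=; rewrite le_max lexx orbT.
exists r; split => //.
- apply: homo_leq => //; first exact: le_trans.
  by move=> n /=; rewrite le_max lexx.
- move=> p px; exists (Num.truncn (x - ratr p)^-1); apply: le_trans (qr _).
  set n := Num.truncn _; rewrite -(ler_rat R); apply: ltW.
  have := qP n; rewrite in_itv => /andP[+ _]; apply: le_lt_trans.
  rewrite lerBrDl -lerBrDr invf_ple ?posrE ?subr_gt0//.
  by rewrite ltW// truncnS_gt.
Qed.

(** The set on which the quantile function is going to be less than x; the strict inequalities match
    the open rays. *)
Let under (h : rat -> R -> R) (x : R) : set (R * R) :=
  [set z | exists q, ratr q < x /\ z.2 < h q z.1].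

Let measurable_under_graph (h : R -> R) : measurable_fun setT h ->
  measurable [set z : R * R | z.2 < h z.1].
Proof.
move=> mh.
have := measurable_fun_ltr (@measurable_snd _ _ R R)
  (measurableT_comp mh (@measurable_fst _ _ R R)) measurableT (Y := [set true]).
by rewrite setTI; apply.
Qed.

Let measurable_under h x : (forall q, measurable_fun setT (h q)) ->
  measurable (under h x).
Proof.
move=> mh; rewrite (_ : under h x =
    \bigcup_(q in [set q : rat | ratr q < x]) [set z : R * R | z.2 < h q z.1]).
  rewrite bigcup_mkcond; apply: bigcupT_measurable_rat => q; case: ifPn => // _.
  exact: measurable_under_graph.
by apply/seteqP; split => z [q]; [case=> a b; exists q|move=> a b; exists q].
Qed.

(** Both sides are limits along nondecreasing rationals r n below x, and at each r n they agree by
    [M_under] and the defining property of h. *)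
Let M_underE (h : rat -> R -> R) x A :
  (forall q, measurable_fun setT (h q)) -> (forall q s, 0 <= h q s <= 1) ->
  (forall q q' s, q <= q' -> h q s <= h q' s) ->
  (forall q A, measurable A -> P (X @^-1` A `&` Z @^-1` `]-oo, ratr q]) =
       (\int[m]_(s in A) (h q s)%:E)%E) -> measurable A ->
  M [set z | A z.1 /\ under h x z] = P (X @^-1` A `&` Z @^-1` `]-oo, x[).
Proof.
move=> mh h01 hmono hE mA.
have [r [rmono rx rcof]] := rat_seq x.
have mA1 : measurable [set z : R * R | A z.1].
  rewrite (_ : [set z : R * R | A z.1] = fst @^-1` A)//.
  by apply: measurable_preimage => //; exact: measurable_fst.
pose W n := [set z : R * R | A z.1 /\ z.2 < h (r n) z.1].
have mW n : measurable (W n).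
  exact: measurableI mA1 (measurable_under_graph (mh (r n))).
pose V n := X @^-1` A `&` Z @^-1` `]-oo, ratr (r n)].
have mXA : measurable (X @^-1` A) by exact: measurable_preimage mX _.
have mV n : measurable (V n) by exact: measurableI.
have -> : [set z | A z.1 /\ under h x z] = \bigcup_n W n.
  apply/seteqP; split => [z [Az [q [qx zq]]]|z [n _ [Az zn]]].
    have [n qn] := rcof q qx; exists n => //; split => //.
    exact: lt_le_trans zq (hmono _ _ _ qn).
  by split => //; exists (r n).
have -> : X @^-1` A `&` Z @^-1` `]-oo, x[ = \bigcup_n V n.
  apply/seteqP; split => [t [/= At]|t [n _ [/= At]]]; rewrite !in_itv/=.
    move=> Zx; have [q] := rat_in_itvoo Zx; rewrite in_itv/= => /andP[Zq qx].
    have [n qn] := rcof q qx; exists n => //; split => //=.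
    by rewrite in_itv/= (le_trans (ltW Zq))// ler_rat.
  by move=> Zr; split => //=; rewrite (le_lt_trans Zr).
have cW : M (W n) @[n --> \oo] --> M (\bigcup_n W n).
  apply: nondecreasing_cvg_mu => //; first exact: bigcupT_measurable.
  move=> a b ab; apply/subsetPset => z [Az za]; split => //.
  by apply: lt_le_trans za _; apply: hmono; exact: rmono.
have cV : P (V n) @[n --> \oo] --> P (\bigcup_n V n).
  apply: nondecreasing_cvg_mu => //; first exact: bigcupT_measurable.
  move=> a b ab; apply/subsetPset => t [At]; rewrite /V /= !in_itv/= => ta; split => //.
  by rewrite (le_trans ta)// ler_rat; exact: rmono.
have MW n : M (W n) = P (V n) by rewrite M_under// -hE.
have MWV : (fun n => M (W n)) = (fun n => P (V n)) by apply/funext => n; rewrite MW.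
rewrite MWV in cW.
exact: cvg_unique cW cV.
Qed.

(* [g] is a conditional quantile function of [Z] given [X]. *)
Lemma transfer : exists g : R * R -> R, measurable_fun setT g /\
  forall A B, measurable A -> measurable B ->
    (m \x unif01)%E [set z | A z.1 /\ B (g z)] = P (X @^-1` A `&` Z @^-1` B).
Proof.
have [h [mh h01 hmono hE]] := monotone_conditional_cdf.
have mU x : measurable (under h x) by exact: measurable_under.
have ME x A : measurable A ->
    M [set z | A z.1 /\ under h x z] = P (X @^-1` A `&` Z @^-1` `]-oo, x[).
  exact: M_underE.
(* Here the set [D z] below is non-empty and bounded below. The complement is null, since
   [under h n] and [under h (- n)] have the masses of {Z < n} and {Z < - n}, which tend to 1 and
   0. *)
pose Good : set (R * R) := (\bigcup_n under h n%:R) `\` (\bigcap_n under h (- n%:R)).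
have mGood : measurable Good.
  by apply: measurableD; [exact: bigcupT_measurable|exact: bigcapT_measurable].
have under_mono x y : x <= y -> under h x `<=` under h y.
  by move=> xy z [q [qx zq]]; exists q; split => //; exact: lt_le_trans xy.
have Good1 : M (~` Good) = 0%E.
  have M1 x : M (under h x) = P (Z @^-1` `]-oo, x[).
    have := ME x setT measurableT; rewrite preimage_setT setTI => <-.
    by congr (M _); apply/seteqP; split => z //; case.
  rewrite /Good setDE setCI setCK; apply: null_set_setU.
  - by apply: measurableC; exact: bigcupT_measurable.
  - exact: bigcapT_measurable.
  - have c1 : M (under h n%:R) @[n --> \oo] --> M (\bigcup_n under h n%:R).
      apply: nondecreasing_cvg_mu => //; first exact: bigcupT_measurable.
      by move=> a b ab; apply/subsetPset; apply: under_mono; rewrite ler_nat.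
    have c2 : M (under h n%:R) @[n --> \oo] --> 1%E.
      rewrite (_ : (fun n => M (under h n%:R)) = fun n => P (Z @^-1` `]-oo, n%:R[)); last first.
        by apply/funext => n; rewrite M1.
      rewrite -(probability_setT P) -[setT](_ : \bigcup_n Z @^-1` `]-oo, n%:R[ = _).
        apply: nondecreasing_cvg_mu; [|apply: bigcupT_measurable|].
        + by move=> n; exact: measurable_preimage mZ _.
        + by move=> n; exact: measurable_preimage mZ _.
        + move=> a b ab; apply/subsetPset => t /=; rewrite !in_itv/= => ta.
          by apply: lt_le_trans ta _; rewrite ler_nat.
      apply/seteqP; split => // t _; exists (Num.truncn `|Z t|).+1 => //=.
      by rewrite in_itv/= (le_lt_trans (ler_norm _))// truncnS_gt.
    have e : M (\bigcup_n under h n%:R) = 1%E by exact: (cvg_unique _ c1 c2).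
    have e2 : M (~` \bigcup_n under h n%:R) = (1 - M (\bigcup_n under h n%:R))%E.
      by apply: probability_setC; exact: bigcupT_measurable.
    by apply: etrans e2 _; rewrite e subee.
  - have c1 : M (under h (- n%:R)) @[n --> \oo] --> M (\bigcap_n under h (- n%:R)).
      apply: nonincreasing_cvg_mu => //.
      + by rewrite ltey_eq fin_num_measure.
      + exact: bigcapT_measurable.
      + by move=> a b ab; apply/subsetPset; apply: under_mono; rewrite lerN2 ler_nat.
    have c2 : M (under h (- n%:R)) @[n --> \oo] --> 0%E.
      rewrite (_ : (fun n => M (under h (- n%:R))) =
          fun n => P (Z @^-1` `]-oo, - n%:R[)); last first.
        by apply/funext => n; rewrite M1.
      rewrite -(measure0 P) -[set0](_ : \bigcap_n Z @^-1` `]-oo, - n%:R[ = _).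
        apply: nonincreasing_cvg_mu; [| |apply: bigcapT_measurable|].
        + by rewrite ltey_eq fin_num_measure//; exact: measurable_preimage mZ _.
        + by move=> n; exact: measurable_preimage mZ _.
        + by move=> n; exact: measurable_preimage mZ _.
        + move=> a b ab; apply/subsetPset => t /=; rewrite !in_itv/= => ta.
          by apply: lt_le_trans ta _; rewrite lerN2 ler_nat.
      apply/seteqP; split => // t /(_ (Num.truncn `|Z t|).+1 I) /=.
      rewrite in_itv/= => Zt; have := truncnS_gt `|Z t|.
      have := ler_norm (- Z t); rewrite normrN; move: Zt; lra.
    exact: (cvg_unique _ c1 c2).
(* The rationals at which the conditional distribution function exceeds the level [z.2]; their
   infimum is the quantile. *)
pose D (z : R * R) : set R := [set x | exists q, x = ratr q /\ z.2 < h q z.1].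
pose g z := if z \in Good then inf (D z) else 0.
have gE x z : Good z -> g z < x <-> under h x z.
  move=> Gz; rewrite /g mem_set//.
  have [[n _ [q0 [q0n zq0]]] Gz2] := Gz.
  split.
  - have D0 : D z !=set0 by exists (ratr q0), q0.
    by move=> /(inf_lt D0)[_ [q [-> zq]] qx]; exists q.
  - move=> [q [qx zq]]; apply: le_lt_trans qx; apply: ge_inf; last by exists q.
    have [k zk] : exists k, ~ under h (- k%:R) z.
      by apply/existsNP => H; apply: Gz2 => k _; exact: H.
    exists (- k%:R) => _ [q' [-> zq']]; rewrite leNgt; apply/negP => lt.
    by apply: zk; exists q'.
have gray x : g @^-1` `]-oo, x[ = (Good `&` under h x) `|`
    (~` Good `&` [set _ | 0 < x]).
  apply/seteqP; split => z; rewrite /= in_itv/=.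
    case: (pselect (Good z)) => Gz gz; first by left; split => //; exact/gE.
    by right; split => //; move: gz; rewrite /g memNset.
  by case=> [[Gz /gE]|[Gz x0]]; [exact|rewrite /g memNset].
have mg : measurable_fun setT g.
  apply: (measurability (@RGenInftyO.G R)); first exact: RGenInftyO.measurableE.
  move=> _ [_ [x ->] <-]; rewrite setTI gray; apply: measurableU.
    exact: measurableI.
  apply: measurableI; first exact: measurableC.
  case: (ltP 0 x) => x0.
    by rewrite (_ : [set _ | _] = setT)//; apply/seteqP; split.
  by rewrite (_ : [set _ | _] = set0)//; apply/seteqP; split.
exists g; split => // A B mA mB.
have mA1 : measurable [set z : R * R | A z.1].
  rewrite (_ : [set z : R * R | A z.1] = fst @^-1` A)//.
  by apply: measurable_preimage => //; exact: measurable_fst.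
have mXA : measurable (X @^-1` A) by exact: measurable_preimage mX _.
rewrite (_ : [set z | _] = g @^-1` B `&` [set z | A z.1]); last first.
  by apply/seteqP; split => z [].
rewrite [X @^-1` A `&` _]setIC.
apply: (@measure_eq_lray _
  (measure_function_pushforward__canonical__measure_function_Measure (mrestr M mA1) mg)
  (measure_function_pushforward__canonical__measure_function_Measure (mrestr P mXA) mZ)) => //.
- change (M (g @^-1` setT `&` [set z | A z.1]) < +oo)%E.
  by rewrite preimage_setT setTI ltey_eq fin_num_measure.
- move=> x; change (M (g @^-1` `]-oo, x[ `&` [set z | A z.1]) =
    P (Z @^-1` `]-oo, x[ `&` X @^-1` A)).
  have MGood W : measurable W -> M W = M (W `&` Good).
    move=> mW.
    have -> : M W = (M (W `\` Good) + M (W `&` Good))%E by exact: measureDI.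
    suff -> : M (W `\` Good) = 0%E by rewrite add0e.
    apply/eqP; rewrite eq_le measure_ge0 andbT -Good1; apply: le_measure.
    - by rewrite inE; exact: measurableD.
    - by rewrite inE; exact: measurableC.
    - by move=> z [].
  have mAU : measurable [set z : R * R | A z.1 /\ under h x z] by exact: measurableI.
  have mAg : measurable (g @^-1` `]-oo, x[ `&` [set z | A z.1]).
    by apply: measurableI => //; exact: measurable_preimage mg _.
  have e : g @^-1` `]-oo, x[ `&` [set z | A z.1] `&` Good =
      [set z | A z.1 /\ under h x z] `&` Good.
    apply/seteqP; split => z [[a b] Gz].
      by split => //; split => //; apply/gE => //; move: a; rewrite /= in_itv.
    by split => //; split => //; rewrite /= in_itv/=; apply/gE.
  have e' : M [set z | A z.1 /\ under h x z] = P (Z @^-1` `]-oo, x[ `&` X @^-1` A).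
    by apply: etrans (ME x A mA) _; congr (P _); exact: setIC.
  exact: etrans (MGood _ mAg) (etrans (congr1 M e) (etrans (esym (MGood _ mAU)) e')).
Qed.

End transfer.

Definition rv d (T : measurableType d) (R : realType) (P : probability T R)
    (f : T -> R) (mf : measurable_fun setT f) : {RV P >-> R} :=
  HB.pack_for {mfun T >-> R} f (isMeasurableFun.Build _ _ _ _ f mf).

(** * An independent sequence of uniform variables and its filtration *)

Section noise_sequence.
Context (R : realType).
Implicit Types (B : nat -> set R) (E : set R) (n : nat).

(** Each step extracts one uniform variable by [lsplit] and keeps [rsplit], independent of it and
    uniform, as a reserve. *)
Definition noise n (x : R) : R := lsplit (iter n rsplit x).

Lemma noiseS n x : noise n.+1 x = noise n (rsplit x).
Proof. by rewrite /noise iterSr. Qed.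

Lemma measurable_iter_rsplit n : measurable_fun setT (iter n (@rsplit R)).
Proof.
elim: n => [|n IH]; first exact: measurable_id.
by apply: measurableT_comp => //; exact: measurable_rsplit.
Qed.

Lemma measurable_noise n : measurable_fun setT (noise n).
Proof.
by apply: measurableT_comp; [exact: measurable_lsplit|exact: measurable_iter_rsplit].
Qed.

Let box n B := [set x | forall j, (j < n)%N -> B j (noise j x)].

Let measurable_box n B : (forall j, measurable (B j)) -> measurable (box n B).
Proof.
move=> mB; rewrite (_ : box n B = \bigcap_(j in `I_n) noise j @^-1` B j)//.
apply: fin_bigcap_measurable => // j _.
exact: measurable_preimage (measurable_noise j) _.
Qed.

(** The reserve is carried along because all later draws are functions of it; the induction peels
    off [noise 0]. *)
Let unif01_box n B E : (forall j, measurable (B j)) -> measurable E ->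
  unif01 (box n B `&` iter n rsplit @^-1` E) =
  (\prod_(j < n) unif01 (B j) * unif01 E)%E.
Proof.
elim: n B => [|n IH] B mB mE.
  rewrite big_ord0 mul1e; congr (unif01 _).
  by apply/seteqP; split => x; [case|move=> Ex; split].
pose B' j := B j.+1.
have e x : iter n.+1 rsplit x = iter n rsplit (rsplit x) by exact: iterSr.
have -> : box n.+1 B `&` iter n.+1 rsplit @^-1` E =
    lsplit @^-1` (B 0%N) `&` rsplit @^-1` (box n B' `&` iter n rsplit @^-1` E).
  apply/seteqP; split => x.
    move=> [bx Ex]; split; first exact: (bx 0%N isT).
    split; last by change (E (iter n rsplit (rsplit x))); rewrite -e; exact: Ex.
    by move=> j jn; rewrite -noiseS; exact: (bx j.+1 jn).
  move=> [b0 [bx Ex]]; split; last by change (E (iter n.+1 rsplit x)); rewrite e; exact: Ex.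
  by case=> [_|j jn]; [exact: b0|rewrite noiseS; exact: bx].
have mb : measurable (box n B' `&` iter n rsplit @^-1` E).
  apply: measurableI; first by apply: measurable_box => j; exact: mB.
  exact: measurable_preimage (measurable_iter_rsplit n) _.
rewrite indep2_split// unif01_lsplit// unif01_rsplit// IH//; last by move=> j; exact: mB.
by rewrite big_ord_recl muleA.
Qed.

Let unif01_boxT n B : (forall j, measurable (B j)) ->
  unif01 (box n B) = (\prod_(j < n) unif01 (B j))%E.
Proof.
move=> mB; have := unif01_box n mB measurableT.
by rewrite preimage_setT setIT probability_setT mule1.
Qed.

Lemma unif01_iter_rsplit n E : measurable E ->
  unif01 (iter n rsplit @^-1` E) = unif01 E.
Proof.
move=> mE; have := unif01_box n (fun=> measurableT) mE.
rewrite big1 ?mul1e; last by move=> i _; exact: probability_setT.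
by move=> <-; congr (unif01 _); apply/seteqP; split => [x Ex|x []//]; split.
Qed.

Lemma unif01_noise n E : measurable E -> unif01 (noise n @^-1` E) = unif01 E.
Proof.
move=> mE; rewrite -[RHS]unif01_lsplit// -[RHS](unif01_iter_rsplit n)//.
exact: measurable_preimage (@measurable_lsplit R) _.
Qed.

Definition past_gen n : set (set R) :=
  [set C | exists j A, [/\ (j < n)%N, measurable A & C = noise j @^-1` A]].

Definition past n := <<s past_gen n >>.

Lemma past_measurable n C : past n C -> measurable C.
Proof.
apply: smallest_sub; first exact: sigma_algebra_measurable.
by move=> _ [j [A [_ mA ->]]]; exact: measurable_preimage (measurable_noise j) _.
Qed.

(** The boxes of [unif01_box] are a pi-system generating the past. *)
Lemma past_indep n C E : past n C -> measurable E ->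
  unif01 (C `&` iter n rsplit @^-1` E) = (unif01 C * unif01 E)%E.
Proof.
move=> pC mE.
have mnE : measurable (iter n rsplit @^-1` E).
  exact: measurable_preimage (measurable_iter_rsplit n) _.
pose G := [set C | exists B, (forall j, measurable (B j)) /\ C = box n B].
have GC : <<s G >> C.
  apply: sub_sigma_algebra2 pC => _ [j [A [jn mA ->]]].
  exists (fun j' => if j' == j then A else setT); split.
    by move=> j'; case: ifP.
  apply/seteqP; split => x; first by move=> Ax j' _; case: eqP => // ->.
  by move=> /(_ j jn); rewrite eqxx.
rewrite -(unif01_iter_rsplit n mE).
apply: (@indep_sigma _ _ _ unif01 G) => //.
- move=> _ _ [B [mB ->]] [B' [mB' ->]]; exists (fun j => B j `&` B' j); split.
    by move=> j; exact: measurableI.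
  apply/seteqP; split => x; first by move=> [h h'] j jn; split; [exact: h|exact: h'].
  by move=> h; split => j jn; have [] := h j jn.
- by move=> _ [B [mB ->]]; exact: measurable_box.
- by move=> _ [B [mB ->]]; rewrite unif01_box// unif01_boxT// unif01_iter_rsplit.
Qed.

Definition noise_rv n : {RV (@unif01 R) >-> R} := rv unif01 (measurable_noise n).

Lemma noise_indep : mutually_independent setT noise_rv.
Proof.
move=> B A _ mA.
pose n := (\max_(j <- B) j).+1.
have Bn j : j \in B -> (j < n)%N by move=> jB; rewrite ltnS (leq_bigmax_seq (F := id)).
(* Padding with the whole line makes the index set an initial segment; the added factors are 1. *)
pose A' j := if j \in B then A j else setT.
have mA' j : measurable (A' j) by rewrite /A'; case: ifP.
rewrite (_ : \bigcap_(j in _) _ = box n A'); last first.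
  apply/seteqP; split => x h j.
    by rewrite /A'; case: ifPn => // jB _; exact: h.
  by move=> /= jB; have := h j (Bn j jB); rewrite /A' jB.
rewrite unif01_boxT// -(big_mkord xpredT (fun j => unif01 (A' j))).
rewrite (eq_bigr (fun j => if j \in B then unif01 (A j) else 1%E)); last first.
  by move=> j _; rewrite /A'; case: ifP => // _; exact: probability_setT.
rewrite -big_mkcond/= -big_filter.
rewrite (eq_bigr (fun j => unif01 (noise j @^-1` A j))); last first.
  by move=> j _; rewrite unif01_noise.
apply: perm_big; apply: uniq_perm.
- by rewrite filter_uniq// iota_uniq.
- exact: fset_uniq.
- move=> j; rewrite mem_filter mem_index_iota leq0n/=.
  by apply/andb_idr => /Bn.
Qed.

End noise_sequence.

Section transfer_noise.
Context (R : realType).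

(** The order of the quantifiers matters: one [g], built from (X, Z) alone, serves every pair (V,
    U), hence every time of the scheme. *)
Lemma transfer_unif01 d (T : measurableType d) (P : probability T R)
    (X Z : {mfun T >-> R}) :
  exists g : R * R -> R, measurable_fun setT g /\
    forall V U : R -> R, measurable_fun setT V -> measurable_fun setT U ->
    (forall A, measurable A -> unif01 (V @^-1` A) = P (X @^-1` A)) ->
    (forall A, measurable A -> unif01 (U @^-1` A) = unif01 A) ->
    indep2 unif01 V U ->
    forall A B, measurable A -> measurable B ->
      unif01 (V @^-1` A `&` (fun x => g (V x, U x)) @^-1` B) =
      P (X @^-1` A `&` Z @^-1` B).
Proof.
have [g [mg gE]] := transfer P X Z; exists g; split => //.
move=> V U mV mU VX Uu VU A B mA mB; rewrite -gE//.
have mVU : measurable_fun setT (fun x => (V x, U x)) by exact: measurable_fun_pair.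
have mA1 : measurable [set z : R * R | A z.1].
  rewrite (_ : [set z : R * R | A z.1] = fst @^-1` A)//.
  by apply: measurable_preimage => //; exact: measurable_fst.
apply/esym; apply: (@product_measure_unique _ _ _ _ _ (distribution P X) unif01
  (measure_function_pushforward__canonical__measure_function_Measure unif01 mVU)).
- move=> C D mC mD.
  have e : unif01 (V @^-1` C `&` U @^-1` D) = (distribution P X C * unif01 D)%E.
    by rewrite VU// VX// Uu.
  exact: e.
- by apply: measurableI => //; exact: measurable_preimage mg _.
Qed.

(** Conditioning on a constant is no conditioning: the conditional quantile function becomes the
    ordinary one. *)
Lemma quantile (mu : probability R R) : exists Q : R -> R,
  measurable_fun setT Q /\ forall A, measurable A -> unif01 (Q @^-1` A) = mu A.
Proof.
have [g [mg gE]] := transfer_unif01 mu (rv mu (measurable_cst (0 : R)))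
  (rv mu (@measurable_id _ R setT)).
exists (fun x => g (0, x)); split.
  by apply: measurableT_comp => //; exact: measurable_fun_pair.
move=> A mA; have := gE (cst 0) id.
move=> /(_ (measurable_cst _) (@measurable_id _ _ _)).
have c0 (P : probability R R) B : P ((fun=> 0 : R) @^-1` B) = (\1_B (0 : R))%:E.
  rewrite indicE; case: (pselect (B 0)) => B0.
    rewrite mem_set//; have -> : (fun=> 0) @^-1` B = [set: R].
      by apply/seteqP; split.
    exact: probability_setT.
  rewrite memNset//; have -> : (fun=> 0) @^-1` B = @set0 R.
    by apply/seteqP; split.
  by apply: etrans (measure0 P) _; rewrite mulr0n.
move=> h; have := h _ _ _ setT A measurableT mA.
rewrite !preimage_setT !setTI; apply => //.
- by move=> B mB; rewrite !c0.
- move=> B C mB mC; rewrite c0 indicE; case: (pselect (B 0)) => B0.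
    rewrite mem_set// mul1e (_ : cst 0 @^-1` B = setT) ?setTI//.
    by apply/seteqP; split.
  rewrite memNset// mul0e (_ : cst 0 @^-1` B = set0) ?set0I ?measure0//.
  by apply/seteqP; split.
Qed.

End transfer_noise.

(** * Independence of transformed families and of blocks *)

Section independent_families.
Context d (T : measurableType d) (R : realType) (P : probability T R).

Lemma mutually_independent_comp (J J' : choiceType) (X : J -> {RV P >-> R})
    (f : J' -> J) (h : J' -> R -> R) (Y : J' -> {RV P >-> R}) :
  mutually_independent setT X -> injective f ->
  (forall j, measurable_fun setT (h j)) ->
  (forall j w, Y j w = h j (X (f j) w)) -> mutually_independent setT Y.
Proof.
move=> indX finj mh YE B A _ mA.
(* Avoids inverting f: at [f j] this is the preimage of [A j] by [h j], and outside the image of f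
   it is the whole line. *)
pose A' j := [set x | forall j', f j' = j -> A j' (h j' x)].
have A'f j : A' (f j) = h j @^-1` A j.
  by apply/seteqP; split => [x /(_ j erefl)//|x Ax j' /finj ->].
have mA' j : measurable (A' j).
  case: (pselect (exists j', f j' = j)) => [[j' <-]|nj].
    by rewrite A'f; exact: measurable_preimage.
  rewrite (_ : A' j = setT)//; apply/seteqP; split => // x _ j' fj.
  by case: nj; exists j'.
have pre j : Y j @^-1` A j = X (f j) @^-1` A' (f j).
  by rewrite A'f; apply/seteqP; split => w /=; rewrite YE.
under [RHS]eq_bigr do rewrite pre.
have uf : uniq [seq f j | j <- B] by rewrite map_inj_uniq// fset_uniq.
have := mutually_independent_seq indX uf (fun _ _ => I) mA'.
rewrite big_map => <-; congr (P _); apply/seteqP; split => w Bw.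
  by move=> _ /mapP[j jB ->]; rewrite -pre; exact: Bw.
by move=> j jB; rewrite pre; apply: Bw; apply/mapP; exists j.
Qed.

(** A finite set of pairs is enlarged to a grid, with the whole line at the added points.
    Independence of the [U j] factors the grid over j, and that of the [h i], under the common law
    Q, factors each block. *)
Lemma mutually_independent_block (I J : choiceType) (U : J -> {RV P >-> R})
    (Q : probability R R) (h : I -> {RV Q >-> R}) (Y : I * J -> {RV P >-> R}) :
  mutually_independent setT U ->
  (forall j A, measurable A -> P (U j @^-1` A) = Q A) ->
  mutually_independent setT h ->
  (forall q w, Y q w = h q.1 (U q.2 w)) -> mutually_independent setT Y.
Proof.
move=> indU UQ indh YE B A _ mA.
pose s := undup [seq q.2 | q <- B]; pose r := undup [seq q.1 | q <- B].
pose A' q := if q \in B then A q else setT.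
have mA' q : measurable (A' q) by rewrite /A'; case: ifP.
pose D j := \bigcap_(i in [set` r]) h i @^-1` A' (i, j).
have mD j : measurable (D j).
  apply: fin_bigcap_measurable => [|i _]; first exact: finite_seq.
  exact: measurable_preimage.
have QD j : Q (D j) = (\prod_(i <- r) Q (h i @^-1` A' (i, j)))%E.
  apply: (mutually_independent_seq indh) => //; exact: undup_uniq.
have -> : \bigcap_(q in [set` B]) Y q @^-1` A q =
    \bigcap_(j in [set` s]) U j @^-1` D j.
  apply/seteqP; split => w Bw.
    move=> j _ i _ /=; rewrite /A'; case: ifPn => // ijB.
    by have := Bw (i, j) ijB; rewrite /= YE.
  move=> [i j] ijB /=; rewrite YE /=.
  have js : j \in s by rewrite mem_undup; apply/mapP; exists (i, j).
  have ir : i \in r by rewrite mem_undup; apply/mapP; exists (i, j).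
  by have := Bw j js i ir; rewrite /= /A' ijB.
rewrite (mutually_independent_seq indU (undup_uniq _))//.
under eq_bigr do rewrite UQ// QD.
transitivity (\prod_(q <- [seq (i, j) | j <- s, i <- r]) Q (h q.1 @^-1` A' q))%E.
  by rewrite big_allpairs_dep.
pose G q := Q (h q.1 @^-1` A q).
rewrite (eq_bigr (fun q => if q \in B then G q else 1%E)); last first.
  move=> q _; rewrite /A'; case: ifP => // _.
  by rewrite preimage_setT; exact: probability_setT.
rewrite -big_mkcond/= -big_filter.
rewrite [RHS](eq_bigr G); last first.
  move=> q _; rewrite /G -(UQ q.2).
    by congr (P _); apply/seteqP; split => w /=; rewrite YE.
  exact: measurable_preimage.
apply: perm_big; apply: uniq_perm.
- rewrite filter_uniq// allpairs_uniq ?undup_uniq//.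
  by move=> [a b] [a' b'] _ _ /= [-> ->].
- exact: fset_uniq.
- move=> [i j]; rewrite mem_filter; apply/andb_idr => ijB.
  apply/allpairsP; exists (j, i); split => //=.
    by rewrite mem_undup; apply/mapP; exists (i, j).
  by rewrite mem_undup; apply/mapP; exists (i, j).
Qed.

End independent_families.

Local Open Scope complex_scope.

(** * Construction of the scheme *)

Section past_measurable_functions.
Context (R : realType).

Definition past_measurable_fun n (f : R -> R) :=
  measurable_fun (setT : set (g_sigma_algebraType (@past_gen R n))) f.

Lemma past_measurable_funP n f :
  past_measurable_fun n f <-> forall A, measurable A -> past n (f @^-1` A).
Proof.
split; first by move=> mf A mA; have := mf measurableT A mA; rewrite setTI.
by move=> pf _ A mA; rewrite setTI; exact: pf.
Qed.

Lemma past_mono m n (C : set R) : (m <= n)%N -> past m C -> past n C.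
Proof.
move=> mn; apply: sub_sigma_algebra2 => _ [j [A [jm mA ->]]].
by exists j, A; split => //; exact: leq_trans mn.
Qed.

Lemma past_measurable_fun_mono m n f : (m <= n)%N ->
  past_measurable_fun m f -> past_measurable_fun n f.
Proof.
move=> mn /past_measurable_funP mf; apply/past_measurable_funP => A mA.
exact: past_mono (mf A mA).
Qed.

Lemma past_measurable_noise m n : (m < n)%N -> past_measurable_fun n (noise m).
Proof.
move=> mn; apply/past_measurable_funP => A mA.
by apply: sub_sigma_algebra; exists m, A.
Qed.

(** Both noise variables are functions of the reserve [iter n rsplit]. The order of the events is
    that of [innovation_indep]: Bernoulli variable, innovations, past. *)
Lemma noise_indep3 n (A B C : set R) : measurable A -> measurable B -> past n C ->
  unif01 (noise n.+1 @^-1` A `&` noise n @^-1` B `&` C) =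
  (unif01 (noise n.+1 @^-1` A) * unif01 (noise n @^-1` B) * unif01 C)%E.
Proof.
move=> mA mB pC; rewrite !unif01_noise//.
have ml : measurable_fun setT (@lsplit R) := @measurable_lsplit R.
have mr : measurable_fun setT (@rsplit R) := @measurable_rsplit R.
have mlA : measurable (lsplit @^-1` A) by exact: measurable_preimage.
pose D := lsplit @^-1` B `&` rsplit @^-1` (lsplit @^-1` A).
have mD : measurable D by apply: measurableI; exact: measurable_preimage.
rewrite setIC (_ : noise n.+1 @^-1` A `&` noise n @^-1` B = iter n rsplit @^-1` D); last first.
  by apply/seteqP; split => x []; split.
rewrite past_indep// indep2_split// unif01_lsplit// unif01_rsplit// unif01_lsplit//.
by rewrite [RHS]muleC [(unif01 A * unif01 B)%E]muleC.
Qed.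

End past_measurable_functions.

(** Every [X j] with j in D is a function of f, so the generators, and with them the sigma-algebra,
    consist of preimages by f. *)
Lemma sigma_gen_factor d (T : measurableType d) (R : realType) (P : probability T R)
    (J : Type) (D : set J) (X : J -> {RV P >-> R}) (f : T -> R) (h : J -> R -> R) :
  (forall j, D j -> measurable_fun setT (h j)) ->
  (forall j w, D j -> X j w = h j (f w)) ->
  forall C, sigma_gen D X C -> exists2 C', measurable C' & C = f @^-1` C'.
Proof.
move=> mh Xh C; rewrite /sigma_gen => sC.
have : <<s preimage_set_system setT f (@measurable _ R) >> C.
  apply: sub_sigma_algebra2 sC => _ [j Dj [A mA <-]].
  exists (h j @^-1` A); first exact: measurable_preimage (mh j Dj) _.
  by rewrite !setTI; apply/seteqP; split => w /=; rewrite Xh.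
rewrite g_sigma_preimageE => -[C' mC' <-]; exists C'; last by rewrite setTI.
have : <<s @measurable _ R >> C' := mC'.
by rewrite sigma_algebra_id//; exact: sigma_algebra_measurable.
Qed.

Section scheme.
Context (R : realType) (k : nat) (b p : R) (mu : probability R R).
Hypothesis p01 : 0 < p < 1.
Hypothesis phiE : forall t, char_fun mu t ^+ k =
  char_fun mu (b * t) ^+ k * (p%:C + (1 - p)%:C * char_fun mu t ^+ k).
Variable Q : R -> R.
Hypothesis mQ : measurable_fun setT Q.
Hypothesis QE : forall A, measurable A -> unif01 (Q @^-1` A) = mu A.

(* One uniform seed determines a whole k-tuple of independent variables of law mu. *)
Let h (i : 'I_k) : {RV (@unif01 R) >-> R} :=
  rv unif01 (measurableT_comp mQ (measurable_noise i)).

Let mh i : measurable_fun setT (h i). Proof. by []. Qed.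

Let h_law i A : measurable A -> unif01 (h i @^-1` A) = mu A.
Proof.
move=> mA; have mQA : measurable (Q @^-1` A) by exact: measurable_preimage mQ _.
by rewrite -QE// -(unif01_noise i mQA).
Qed.

Let h_indep : mutually_independent setT h.
Proof.
apply: (@mutually_independent_comp _ _ _ _ _ _ (@noise_rv R) (@nat_of_ord k) (fun=> Q)).
- exact: noise_indep.
- exact: val_inj.
- by [].
- by [].
Qed.

Let S x := \sum_(i < k) h i x.

Let mS : measurable_fun setT S. Proof. exact: measurable_sum. Qed.

Let cf_S t : cf unif01 S t = char_fun mu t ^+ k.
Proof. by apply: cf_sum_iid => // i A mA; exact: h_law. Qed.

(** Draws a seed given the value V of its sum, with U as randomization: (V, g (V, U)) has the law of
    (S, identity). *)
Variable g : R * R -> R.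
Hypothesis mg : measurable_fun setT g.
Hypothesis gE : forall V U : R -> R,
  measurable_fun setT V -> measurable_fun setT U ->
  (forall A, measurable A -> unif01 (V @^-1` A) = unif01 (S @^-1` A)) ->
  (forall A, measurable A -> unif01 (U @^-1` A) = unif01 A) ->
  indep2 unif01 V U ->
  forall A B, measurable A -> measurable B ->
    unif01 (V @^-1` A `&` (fun x => g (V x, U x)) @^-1` B) =
    unif01 (S @^-1` A `&` B).

Let bern n (x : R) : R := \1_`[p, +oo[%classic (noise (3 * n).+1 x).

(* Step n consumes three noise variables: [noise (3 * n)] is the seed of the
   innovations, [noise (3 * n).+1] drives the Bernoulli variable, and
   [noise (3 * n).+2] randomizes the choice of the new seed by [g]. *)
Fixpoint state n x : R := if n is m.+1 then
    g (b * S (state m x) + bern n x * S (noise (3 * n) x), noise (3 * n).+2 x)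
  else noise 0 x.

(** The right-hand side of the recursion at time n + 1, on which the new seed is conditioned. *)
Let target n x := b * S (state n x) + bern n.+1 x * S (noise (3 * n.+1) x).

Let m1 : measurable_fun setT (\1_`[p, +oo[%classic : R -> R).
Proof. exact: measurable_indic. Qed.

(** [state n] reads noise of index below 3 (n + 1). The target adds the indices 3 (n + 1) and 3 (n +
    1) + 1, which leaves [noise (3 * n.+1).+2] fresh for the draw by [g]. *)
Let past_target n : past_measurable_fun (3 * n.+1) (state n) ->
  past_measurable_fun (3 * n.+1).+2 (target n).
Proof.
move=> pn; rewrite /past_measurable_fun; apply: measurable_funD.
  apply: measurable_funM => //; apply: measurableT_comp mS _.
  by apply: past_measurable_fun_mono pn; lia.
apply: measurable_funM.
  by apply: measurableT_comp m1 _; exact: past_measurable_noise.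
by apply: measurableT_comp mS _; exact: past_measurable_noise.
Qed.

Let past_state n : past_measurable_fun (3 * n.+1) (state n).
Proof.
elim: n => [|n IH]; first exact: past_measurable_noise.
have pt := past_target IH.
rewrite /past_measurable_fun (_ : state n.+1 =
  g \o (fun x => (target n x, noise (3 * n.+1).+2 x)))//.
apply: measurableT_comp mg _; apply: measurable_fun_pair.
  by apply: past_measurable_fun_mono pt; lia.
by apply: past_measurable_noise; lia.
Qed.

Let measurable_of_past n (f : R -> R) : past_measurable_fun n f -> measurable_fun setT f.
Proof.
move=> /past_measurable_funP pf _ A mA; rewrite setTI.
exact: past_measurable (pf A mA).
Qed.

Let measurable_state n : measurable_fun setT (state n).
Proof. exact: (@measurable_of_past (3 * n.+1)%N _ (@past_state n)). Qed.

Let measurable_bern n : measurable_fun setT (bern n).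
Proof. by apply: measurableT_comp m1 _; exact: measurable_noise. Qed.

Let measurable_target n : measurable_fun setT (target n).
Proof.
exact: (@measurable_of_past (3 * n.+1).+2 _ (past_target (@past_state n))).
Qed.

Let bern01 n x : bern n x = 0 \/ bern n x = 1.
Proof. by rewrite /bern indicE; case: (_ \in _); [right|left]. Qed.

Let bern_eq0 n : unif01 [set x | bern n x = 0] = p%:E.
Proof.
have -> : [set x | bern n x = 0] = noise (3 * n).+1 @^-1` `]-oo, p[.
  apply/seteqP; split => x; rewrite /= in_itv/= /bern indicE.
    case: (ltP (noise (3 * n).+1 x) p) => // px.
    by rewrite mem_set /= ?in_itv/= ?px// => /eqP; rewrite oner_eq0.
  by move=> xp; rewrite memNset//= in_itv/= andbT leNgt xp.
by rewrite unif01_noise// unif01_lray clip_id//; have := p01; lra.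
Qed.

Let bern_eq1 n : unif01 [set x | bern n x = 1] = (1 - p)%:E.
Proof.
have -> : [set x | bern n x = 1] = ~` [set x | bern n x = 0].
  apply/seteqP; split => x /=; first by move=> -> /eqP; rewrite oner_eq0.
  by case: (bern01 n x).
have m0 : measurable [set x | bern n x = 0].
  by apply: (@measurable_preimage _ _ _ _ (bern n) [set 0]).
by apply: etrans (probability_setC _ m0) _; rewrite bern_eq0.
Qed.

Let cf_state n t : (forall A, measurable A -> unif01 (state n @^-1` A) = unif01 A) ->
  cf unif01 (fun x => S (state n x)) t = char_fun mu t ^+ k.
Proof.
move=> law; rewrite -cf_S; pose nu : probability R R := distribution unif01 (rv unif01 mS).
rewrite (@cf_law _ _ _ _ (fun x => S (state n x)) nu).
- by rewrite (@cf_law _ _ _ _ S nu).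
- exact: measurableT_comp mS (measurable_state n).
- by move=> A mA; rewrite (law (S @^-1` A))//; exact: measurable_preimage mS _.
Qed.

(** The functional equation enters here: with [cf_AR1] it gives the target the characteristic
    function of [S], and [char_fun_inj] yields equality of laws. *)
Let target_law n : (forall A, measurable A -> unif01 (state n @^-1` A) = unif01 A) ->
  forall A, measurable A -> unif01 (target n @^-1` A) = unif01 (S @^-1` A).
Proof.
move=> law A mA.
pose nu1 : probability R R := distribution unif01 (rv unif01 (measurable_target n)).
pose nu2 : probability R R := distribution unif01 (rv unif01 mS).
have mSs : measurable_fun setT (fun x => S (state n x)).
  exact: measurableT_comp mS (measurable_state n).
have mSe : measurable_fun setT (fun x => S (noise (3 * n.+1) x)).
  exact: measurableT_comp mS (measurable_noise _).
apply: (@char_fun_inj _ nu1 nu2) => // t.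
rewrite -(@cf_law _ _ _ unif01 (target n) nu1)//.
rewrite -(@cf_law _ _ _ unif01 S nu2)//.
rewrite (@cf_AR1 _ _ _ unif01 (fun x => S (state n x)) (bern n.+1)
  (fun x => S (noise (3 * n.+1) x)) b p)//.
- rewrite cf_state// cf_S [RHS]phiE; congr (_ * (_ + _ * _)).
  rewrite -cf_S (@cf_law _ _ _ _ (fun x => S (noise _ x)) nu2)//.
    by rewrite (@cf_law _ _ _ _ S nu2).
  by move=> B mB; rewrite (unif01_noise _ (measurable_preimage mS mB)).
- move=> B C D mB mC mD.
  apply: (@noise_indep3 R (3 * n.+1) (\1_`[p, +oo[%classic @^-1` B) (S @^-1` C)).
  + exact: measurable_preimage m1 _.
  + exact: measurable_preimage mS _.
  + have /past_measurable_funP := @past_state n.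
    by move=> /(_ (S @^-1` D)); apply; exact: measurable_preimage mS _.
Qed.

Let indep_target n : indep2 unif01 (target n) (noise (3 * n.+1).+2).
Proof.
move=> A B mA mB.
have /past_measurable_funP pt := past_target (@past_state n).
rewrite (unif01_noise _ mB) -(unif01_lsplit mB).
exact: past_indep (pt A mA) (measurable_preimage (@measurable_lsplit R) mB).
Qed.

(** When the first event of [gE] is everything, its right-hand side is the uniform measure, so the
    drawn seed meets the hypothesis of [target_law] at the next time. *)
Let state_law n A : measurable A -> unif01 (state n @^-1` A) = unif01 A.
Proof.
elim: n A => [|n IH] A mA; first exact: unif01_noise.
have := gE (measurable_target n) (measurable_noise (3 * n.+1).+2) (target_law IH)
  (fun A mA => unif01_noise (3 * n.+1).+2 mA) (@indep_target n) measurableT mA.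
by rewrite !preimage_setT !setTI.
Qed.

Let state_target n A B : measurable A -> measurable B ->
  unif01 (target n @^-1` A `&` state n.+1 @^-1` B) = unif01 (S @^-1` A `&` B).
Proof.
apply: gE; [exact: measurable_target|exact: measurable_noise| | |exact: indep_target].
- by apply: target_law => A' mA'; exact: state_law.
- by move=> A' mA'; exact: unif01_noise.
Qed.

(* Both inequalities between S (state n.+1) and target n are detected by
   rational thresholds, and the joint law is that of (S, id). *)
Let state_ae n : {ae unif01, forall x, S (state n.+1 x) = target n x}.
Proof.
pose N1 (q : rat) := target n @^-1` `]-oo, ratr q[ `&`
  state n.+1 @^-1` (S @^-1` `[ratr q, +oo[).
pose N2 (q : rat) := target n @^-1` `[ratr q, +oo[ `&`
  state n.+1 @^-1` (S @^-1` `]-oo, ratr q[).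
have mSp A : measurable A -> measurable (S @^-1` A) by exact: measurable_preimage.
have mN1 q : measurable (N1 q).
  apply: measurableI; first exact: measurable_preimage (measurable_target n) _.
  by apply: measurable_preimage; [exact: measurable_state|exact: mSp].
have mN2 q : measurable (N2 q).
  apply: measurableI; first exact: measurable_preimage (measurable_target n) _.
  by apply: measurable_preimage; [exact: measurable_state|exact: mSp].
have N10 q : unif01 (N1 q) = 0%E.
  rewrite /N1 state_target//; last exact: mSp.
  rewrite -preimage_setI (_ : _ `&` _ = set0) ?preimage_set0 ?measure0//.
  by apply/seteqP; split => // y [] /=; rewrite !in_itv/= andbT leNgt => ->.
have N20 q : unif01 (N2 q) = 0%E.
  rewrite /N2 state_target//; last exact: mSp.
  rewrite -preimage_setI (_ : _ `&` _ = set0) ?preimage_set0 ?measure0//.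
  by apply/seteqP; split => // y [] /=; rewrite !in_itv/= andbT leNgt => /negbTE ->.
have N0 : unif01.-negligible (\bigcup_(q : rat) (N1 q `|` N2 q)).
  pose F m := if @choice.unpickle rat m is Some q then N1 q `|` N2 q else set0.
  have FE q : F (choice.pickle q) = N1 q `|` N2 q by rewrite /F choice.pickleK.
  apply: (@negligibleS _ _ _ _ (\bigcup_m F m)).
    by move=> x [q _ Nx]; exists (choice.pickle q); [exact: I|rewrite FE; exact: Nx].
  apply: negligible_bigcup => m; rewrite /F.
  case: (choice.unpickle m) => [q|]; last exact: negligible_set0.
  apply: negligibleU; apply/negligibleP.
  - exact: mN1.
  - exact: N10.
  - exact: mN2.
  - exact: N20.
apply: negligibleS N0 => x /= /eqP neq.
case: (ltgtP (target n x) (S (state n.+1 x))) => lt.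
- have [q] := rat_in_itvoo lt; rewrite in_itv/= => /andP[q1 q2].
  by exists q => //; left; split; rewrite /= in_itv/= ?(ltW q2).
- have [q] := rat_in_itvoo lt; rewrite in_itv/= => /andP[q1 q2].
  by exists q => //; right; split; rewrite /= in_itv/= ?(ltW q2).
- by move: neq; rewrite lt eqxx.
Qed.

Let AR1_pos n : (0 < n)%N -> {ae unif01, forall x,
  S (state n x) = b * S (state n.-1 x) + bern n x * S (noise (3 * n) x)}.
Proof. by case: n => // n _; exact: state_ae. Qed.

Definition scheme_Y (i : 'I_k) n : {RV (@unif01 R) >-> R} :=
  rv unif01 (measurableT_comp (mh i) (measurable_state n)).
Definition scheme_eps (i : 'I_k) n : {RV (@unif01 R) >-> R} :=
  rv unif01 (measurableT_comp (mh i) (measurable_noise (3 * n))).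
Definition scheme_I n : {RV (@unif01 R) >-> R} := rv unif01 (measurable_bern n).

Let Y_law i n A : measurable A -> unif01 (scheme_Y i n @^-1` A) = mu A.
Proof.
move=> mA; have mhA := measurable_preimage (mh i) mA.
by rewrite -(h_law i mA) -(state_law n mhA).
Qed.

Let eps_law i n A : measurable A -> unif01 (scheme_eps i n @^-1` A) = mu A.
Proof.
move=> mA; have mhA := measurable_preimage (mh i) mA.
by rewrite -(h_law i mA) -(unif01_noise (3 * n) mhA).
Qed.

Lemma scheme_AR1 : randomized_additive_AR1 b p scheme_Y scheme_eps scheme_I.
Proof.
split.
- by move=> n x _; exact: bern01.
- by move=> n _; exact: bern_eq0.
- by move=> n _; exact: bern_eq1.
- move=> n; split; last first.
    by move=> i j _ _ A mA; apply: etrans (Y_law i n mA) (esym (Y_law j n mA)).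
  move=> B A sB mA.
  have mhA i : measurable (h i @^-1` A i) by exact: measurable_preimage (mh i) _.
  pose W := \bigcap_(i in [set` B]) h i @^-1` A i.
  have mW : measurable W.
    by apply: fin_bigcap_measurable => // i _; exact: mhA.
  (* All the [Y i n] are decoded from the single uniform seed [state n], so their joint law is that
     of the [h i]. *)
  transitivity (unif01 (state n @^-1` W)); first by [].
  rewrite state_law// h_indep//; apply: eq_bigr => i _.
  by rewrite -(state_law n (mhA i)).
- split; last first.
    by move=> i j _ _ A mA; apply: etrans (eps_law _ _ mA) (esym (eps_law _ _ mA)).
  have ind3 : mutually_independent setT (fun n => noise_rv R (3 * n)).
    apply: (@mutually_independent_comp _ _ _ _ _ _ (@noise_rv R) (fun n => 3 * n)%N
      (fun=> id)) => //.
    + exact: noise_indep.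
    + by move=> m n; lia.
  (* Innovations of different times come from independent seeds [noise (3 * n)], those of one time
     from the independent [h i]. *)
  have := @mutually_independent_block _ _ _ _ _ _ _ unif01 h
    (fun q => scheme_eps q.1 q.2) ind3 (fun n A => @unif01_noise R (3 * n) A) h_indep
    (fun _ _ => erefl).
  by move=> ind B A _ mA; exact: ind.
- move=> n n0 A B C sA sB sC.
  have IE j x : [set n] j ->
      scheme_I j x = (\1_`[p, +oo[%classic : R -> R) (noise (3 * n).+1 x).
    by move=> ->.
  have [A' mA' ->] := @sigma_gen_factor _ _ _ _ _ _ scheme_I (noise (3 * n).+1)
    (fun=> \1_`[p, +oo[%classic : R -> R) (fun _ _ => m1) IE _ sA.
  have [B' mB' ->] := @sigma_gen_factor _ _ _ _ _ _ (fun i => scheme_eps i n)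
    (noise (3 * n)) h (fun i _ => mh i) (fun _ _ _ => erefl) _ sB.
  apply: noise_indep3 => //.
  apply: smallest_sub sC; first exact: smallest_sigma_algebra.
  move=> _ [[i m] /= mn [D mD <-]]; rewrite setTI.
  (* As m < n, [state m] reads only noise of index below 3 (m + 1) <= 3 n. *)
  have pm : past_measurable_fun (3 * n) (state m).
    by apply: past_measurable_fun_mono (@past_state m); lia.
  have /past_measurable_funP := pm; move=> /(_ (h i @^-1` D)); apply.
  exact: measurable_preimage (mh i) _.
- have : {ae unif01, forall x n, (0 < n)%N -> S (state n x) =
      b * S (state n.-1 x) + bern n x * S (noise (3 * n) x)}.
    apply/ae_foralln => n; case: n => [|n]; first by apply: aeW.
    by apply: filterS (AR1_pos (ltn0Sn n)).
  by [].
Qed.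

Lemma scheme_exists : exists (d : measure_display) (T : measurableType d)
    (P : probability T R) (Y eps : 'I_k -> nat -> {RV P >-> R}) (I : nat -> {RV P >-> R}),
  [/\ randomized_additive_AR1 b p Y eps I, marginally_stationary Y,
      forall i, same_law (Y i 0%N) (eps i 1%N) & forall i n, has_law (Y i n) mu].
Proof.
exists _, R, unif01, scheme_Y, scheme_eps, scheme_I; split.
- exact: scheme_AR1.
- by move=> i n _ A mA; apply: etrans (Y_law _ _ mA) (esym (Y_law _ _ mA)).
- by move=> i A mA; apply: etrans (Y_law _ _ mA) (esym (eps_law _ _ mA)).
- by move=> i n A mA; exact: Y_law.
Qed.

End scheme.

(** With f = 1 / (1 + psi) the identity reduces to p (1 + psi t) + 1 - p = 1 + p psi t = 1 + psi (b
    t); the denominators at t and b t are nonzero by [is_inv_root_branch]. *)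
Lemma AR1_char_fun_of_gen_semi_alpha_Laplace (R : realType) (k : nat) (b p : R)
    (mu : probability R R) : p != 0 -> gen_semi_alpha_Laplace p^-1 b k mu ->
  forall t, char_fun mu t ^+ k =
    char_fun mu (b * t) ^+ k * (p%:C + (1 - p)%:C * char_fun mu t ^+ k).
Proof.
move=> p0 [psi [[_ _ phiE] psiE _]] t.
have [zt ->] := phiE t; have [zbt ->] := phiE (b * t).
have e : psi (b * t) = p%:C * psi t.
  by rewrite (psiE t) mulrA -rmorphM /= mulfV// rmorph1 mul1r.
rewrite e in zbt *; rewrite rmorphB rmorph1.
by field; rewrite zt zbt.
Qed.

Local Close Scope complex_scope.

Theorem theorem2p3 (R : realType) (k : nat) (b p : R) (mu : probability R R)
    (hk : (0 < k)%N) (hb : 0 < b < 1) (hp : 0 < p < 1)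
    (h0 : mu [set 0] = 1%E -> b ^+ 2 <= p) :
  (exists (d : measure_display) (T : measurableType d) (P : probability T R)
      (Y eps : 'I_k -> nat -> {RV P >-> R}) (I : nat -> {RV P >-> R}),
    [/\ randomized_additive_AR1 b p Y eps I,
        marginally_stationary Y,
        forall i, same_law (Y i 0%N) (eps i 1%N) &
        forall i n, has_law (Y i n) mu])
  <-> gen_semi_alpha_Laplace p^-1 b k mu.
Proof.
split=> [[d [T [P [Y [eps [I [AR _ stat Ymu]]]]]]]|/AR1_char_fun_of_gen_semi_alpha_Laplace].
  by apply: gen_semi_alpha_Laplace_of_AR1 => // t; exact: char_fun_AR1 AR stat Ymu t.
have [p0 _] := andP hp; move=> /(_ (lt0r_neq0 p0)) phiE.
have [Q [mQ QE]] := quantile mu.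
have mS : measurable_fun setT (fun x : R => \sum_(i < k) Q (noise i x)).
  apply: measurable_sum => i.
  exact: measurableT_comp mQ (measurable_noise i).
(* The second variable is the identity: [g] draws the seed itself, conditionally on the sum of the
   vector that it encodes. *)
have [g [mg gE]] :=
  transfer_unif01 unif01 (rv unif01 mS) (rv unif01 (@measurable_id _ R setT)).
refine (@scheme_exists R k b p mu hp phiE Q mQ QE g mg _).
move=> V U mV mU VS Uu VU A B mA mB; exact: (gE V U mV mU VS Uu VU A B mA mB).
Qed.
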